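(* Fix $a\in\mathbb{N}$. No nonempty finite system of congruence conditions on $b$ can force $d(a,b)\geq 7$ for every positive integer $b$ satisfying those conditions. That is, for every finite system of congruence conditions on $b$ that is satisfied by at least one integer, there is a positive integer $b$ satisfying the system with $d(a,b)\leq 6$.
   Context: Let $\mathbb{N}=\{1,2,\ldots\}$. $G$ is the undirected simple graph with vertex set $\mathbb{N}$ in which $x\sim y$ if and only if $|x-y|=1$ or $\max\{x,y\}/\min\{x,y\}$ is a prime number. $d(x,y)$ denotes graph distance in $G$. A finite system of congruence conditions on $b$ describes a union of residue classes modulo a common modulus $M\geq 1$; it is nonempty if this union is nonempty. *)

(* Defs.v *)
From HB Require Import structures.
From mathcomp Require Import all_boot all_order all_algebra.
From mathcomp Require Import boolp.

Set Implicit Arguments.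
Unset Strict Implicit.
Unset Printing Implicit Defensive.

Definition vertex : Type := {n : nat | 0 < n}.

Definition adj : rel vertex := fun x y =>
  [|| val x == (val y).+1, val y == (val x).+1 |
      let m := minn (val x) (val y) in
      let M := maxn (val x) (val y) in (m %| M) && prime (M %/ m)].

Definition walk (x y : vertex) (n : nat) : Prop :=
  exists p : seq vertex, [/\ path adj x p, last x p = y & size p = n].

Lemma adj_sym : symmetric adj.
Proof. by move=> x y; rewrite /adj minnC maxnC orbCA. Qed.

Lemma adj_irr : irreflexive adj.
Proof.
by move=> [n n0]; rewrite /adj /= minnn maxnn dvdnn divnn n0 !(ltn_eqF, gtn_eqF).
Qed.

Lemma walk_step x y z n : adj x y -> walk y z n -> walk x z n.+1.
Proof. by move=> xy [p [yp <- <-]]; exists (y :: p); rewrite /= xy. Qed.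

Lemma walk_add k (x y : vertex) :
  val y = val x + k -> walk x y k /\ walk y x k.
Proof.
elim: k x => [|k IHk] x; first by rewrite addn0 => /val_inj ->; split; exists [::].
rewrite addnS -addSn => yE; pose x' : vertex := exist _ (val x).+1 isT.
have xx' : adj x x' by rewrite /adj /= eqxx orbT.
have [x'y [p [yp plast psize]]] := IHk x' yE; split; first exact: walk_step x'y.
exists (rcons p x); rewrite rcons_path yp plast adj_sym xx'.
by rewrite last_rcons size_rcons psize.
Qed.

Lemma connected (x y : vertex) : exists n, `[< walk x y n >].
Proof.
have [xy|/ltnW yx] := leqP (val x) (val y).
  by exists (val y - val x); apply/asboolP; apply: (walk_add _).1; rewrite subnKC.
by exists (val x - val y); apply/asboolP; apply: (walk_add _).2; rewrite subnKC.
Qed.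

Definition dist (x y : vertex) : nat := ex_minn (connected x y).

(* A finite system of congruence conditions is represented by the union of
   residue classes it describes; an element of ['I_modulus] stands for its
   residue class. *)
Record congr_system := CongrSystem {
  modulus : nat;
  modulus_gt0 : 0 < modulus;
  residues : {set 'I_modulus} }.

Definition satisfies (S : congr_system) (z : int) : Prop :=
  exists2 r : 'I_(modulus S),
    r \in residues S & (z = (val r)%:Z %[mod (modulus S)%:Z])%Z.

(* Main.v *)
(** Dirichlet's theorem, proved below by real, elementary means, reduces the
    statement to a solvability question for units modulo [M].  Starting from [a],
    the walk
      a, a p, a p + 1, (a p + 1) q, (a p + 1) q + 1, ((a p + 1) q + 1) s
    has length 5 for all primes [p], [q], [s].  With [p], [q], [s] units modulo
    [M], the last term can be made congruent to any [Y] of the parity of [a]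
    (check this modulo prime powers); for the other parity, add a step [+1].

    For Dirichlet's theorem modulo [N], write [f] for a real function on the
    units modulo [N] with mean zero, extended by 0 to all integers.  The sums
    [sum_(n <= x) f(g n) / n] converge to a limit [L f (g)] with error O(1/x).
    From [ln = 1 * Lambda] one gets [sum_(n <= x) Lambda(n)/n (L f)(g n) = O(1)],
    so it suffices to show that [L] is injective, hence onto, on mean-zero
    functions.  If [L f = 0], Moebius inversion gives
    [sum_(n <= x) Lambda(n)/n f(g n) = - f(g) ln x + O(1)].  At a point [g] where
    [|f|] is maximal this forces [f(g s) = - f(g)] for every class [s] on which
    [sum Lambda(n)/n] is unbounded; as functions invariant under all such [s]
    are constant, [f / f(1)] is a nontrivial real character [X] with
    [sum X(n)/n = 0].  This is impossible, since [1 * X] is nonnegative and at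
    least 1 on squares. *)
Require Import Defs.
From mathcomp Require Import all_boot all_order all_algebra all_solvable.
From mathcomp Require Import boolp classical_sets reals exp Rstruct.
From mathcomp Require Import ring lra zify.

Set Implicit Arguments.
Unset Strict Implicit.
Unset Printing Implicit Defensive.

Import Order.TTheory GRing.Theory Num.Theory.

(** * Divisor sums and arithmetic functions *)

Section DivisorSums.

Local Open Scope ring_scope.
Variable V : nmodType.
Implicit Types (n m x p k : nat).

Lemma sum_divisors_dvd n x (F : nat -> V) : (0 < n <= x)%N ->
  \sum_(d <- divisors n) F d = \sum_(1 <= d < x.+1 | (d %| n)%N) F d.
Proof.
move=> /andP[n_gt0 n_le]; rewrite -[RHS]big_filter; apply: perm_big.
apply: uniq_perm; first exact: divisors_uniq.
  by rewrite filter_uniq // iota_uniq.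
move=> d; rewrite mem_filter mem_index_iota -dvdn_divisors //.
case: (boolP (d %| n)%N) => //= dn; rewrite (dvdn_gt0 n_gt0 dn) /=.
by rewrite ltnS (leq_trans (dvdn_leq n_gt0 dn)).
Qed.

Lemma sum_multiples d x (F : nat -> V) : (0 < d)%N ->
  \sum_(1 <= n < x.+1 | (d %| n)%N) F (n %/ d)%N =
  \sum_(1 <= m < (x %/ d).+1) F m.
Proof.
move=> d_gt0; elim: x => [|x IHx]; first by rewrite div0n !big_geq.
rewrite big_mkcond big_nat_recr //= -big_mkcond IHx divnS //.
case: (boolP (d %| x.+1)%N) => dx; last by rewrite add0n addr0.
by rewrite add1n [RHS]big_nat_recr //= divnS // dx.
Qed.

Lemma sum_divisors_swap x (F : nat -> nat -> V) :
  \sum_(1 <= n < x.+1) \sum_(d <- divisors n) F d (n %/ d)%N =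
  \sum_(1 <= d < x.+1) \sum_(1 <= m < (x %/ d).+1) F d m.
Proof.
rewrite (eq_big_nat _ _ (F2 := fun n =>
  \sum_(1 <= d < x.+1 | (d %| n)%N) F d (n %/ d)%N)) => [|n /andP[n0 nx]]; last first.
  by rewrite (@sum_divisors_dvd _ x) // n0 -ltnS.
rewrite (exchange_big_dep_nat predT) //=; apply: eq_big_nat => d /andP[d0 _].
exact: sum_multiples.
Qed.

(** Each divisor of [p ^ k * m] is [p ^ i * d] for exactly one [i <= k] and one divisor [d] of
    [m]. *)
Lemma sum_divisors_pfactor p k m (F : nat -> V) :
  prime p -> ~~ (p %| m)%N -> (0 < m)%N ->
  \sum_(d <- divisors (p ^ k * m)%N) F d =
  \sum_(i < k.+1) \sum_(d <- divisors m) F (p ^ i * d)%N.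
Proof.
move=> p_pr pm m0; have p0 := prime_gt0 p_pr.
have pNd d i : d \in divisors m -> logn p (p ^ i * d)%N = i.
  rewrite -dvdn_divisors // => dm; have d0 := dvdn_gt0 m0 dm.
  rewrite lognM ?expn_gt0 ?p0 // pfactorK // lognE p_pr d0 /=.
  by case: ifP; rewrite ?addn0 // => pd; rewrite (dvdn_trans pd dm) in pm.
rewrite -(big_mkord predT (fun i => \sum_(d <- divisors m) F (p ^ i * d)%N)).
rewrite -(big_allpairs_dep (h := fun i d => (p ^ i * d)%N)
  (r2 := fun=> divisors m)).
apply: perm_big; apply: uniq_perm; first exact: divisors_uniq.
  apply: allpairs_uniq; [exact: iota_uniq|exact: divisors_uniq|].
  move=> [i d] [j e] /allpairsP[[i1 d1] [_ dm [-> ->]]].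
  move=> /allpairsP[[j1 e1] [_ em [-> ->]]] eq_ie.
  rewrite /= in dm em eq_ie *.
  have /eqP := congr1 (logn p) eq_ie; rewrite !pNd // => /eqP ij.
  by move: eq_ie; rewrite ij => /eqP; rewrite eqn_pmul2l ?expn_gt0 ?p0 // => /eqP ->.
have pm0 : (0 < p ^ k * m)%N by rewrite muln_gt0 expn_gt0 p0.
move=> d; rewrite -dvdn_divisors //; apply/idP/allpairsP => [dm|].
  have d0 := dvdn_gt0 pm0 dm.
  have [e pe dE] := pfactor_coprime p_pr d0.
  exists (logn p d, e) => /=; split; last by rewrite mulnC.
    rewrite mem_index_iota /= ltnS; have := dvdn_leq_log p pm0 dm.
    by rewrite pNd // -dvdn_divisors.
  rewrite -dvdn_divisors //.
  have ed : (e %| p ^ k * m)%N by apply: dvdn_trans dm; rewrite dE dvdn_mulr.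
  by rewrite -(@Gauss_dvdr e (p ^ k)) // coprime_sym coprimeXl.
move=> [[i e] /= []]; rewrite mem_index_iota -dvdn_divisors // => /andP[_ ik] em ->.
by rewrite dvdn_mul // dvdn_exp2l.
Qed.

(** Induction adapted to multiplicative functions: the full power of one prime, here the least, is
    split off at each step. *)
Lemma pfactor_ind (P : nat -> Prop) :
  P 1%N ->
  (forall p k m, prime p -> (0 < k)%N -> ~~ (p %| m)%N -> (0 < m)%N ->
    P m -> P (p ^ k * m)%N) ->
  forall n, (0 < n)%N -> P n.
Proof.
move=> P1 PX; elim/ltn_ind => n IHn n0.
have [->//|n_gt1] : n = 1%N \/ (1 < n)%N by lia.
have p_pr := pdiv_prime n_gt1.
have [m pm nE] := pfactor_coprime p_pr n0.
have k0 : (0 < logn (pdiv n) n)%N by rewrite logn_gt0 mem_primes p_pr n0 pdiv_dvd.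
have m0 : (0 < m)%N by case: (m) nE n0 => // ->.
rewrite nE mulnC; apply: PX => //; first by rewrite -prime_coprime.
apply: IHn => //; rewrite [ltnRHS]nE -[ltnLHS]muln1 ltn_pmul2l //.
by rewrite -[ltnLHS](exp1n (logn (pdiv n) n)) ltn_exp2r // prime_gt1.
Qed.

End DivisorSums.

(** * The von Mangoldt and Moebius functions *)

Section ArithmeticFunctions.

Local Open Scope ring_scope.
Variable R : realType.
Implicit Types (n m x p k : nat).

Definition lnn n : R := ln n%:R.

Definition mangoldt n : R := if size (primes n) == 1%N then lnn (pdiv n) else 0.

Definition moebius n : R :=
  \prod_(p <- primes n) (if logn p n == 1%N then -1 else 0).

Lemma lnn1 : lnn 1 = 0.
Proof. exact: ln1. Qed.

Lemma lnnM m n : (0 < m)%N -> (0 < n)%N -> lnn (m * n)%N = lnn m + lnn n.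
Proof. by move=> m0 n0; rewrite /lnn natrM lnM // posrE ltr0n. Qed.

Lemma lnnX m k : (0 < m)%N -> lnn (m ^ k)%N = lnn m *+ k.
Proof. by move=> m0; rewrite /lnn natrX lnXn // ltr0n. Qed.

Lemma lnn_ge0 n : 0 <= lnn n.
Proof.
case: n => [|n]; first by rewrite /lnn ln0.
by rewrite ln_ge0 // ler1n.
Qed.

Lemma ler_lnn m n : (m <= n)%N -> lnn m <= lnn n.
Proof.
case: m => [|m] mn; first by rewrite {1}/lnn ln0 ?lnn_ge0.
by rewrite /lnn ler_ln ?posrE ?ler_nat ?ltr0n // (leq_trans _ mn).
Qed.

Lemma mangoldt_ge0 n : 0 <= mangoldt n.
Proof. by rewrite /mangoldt; case: ifP => // _; apply: lnn_ge0. Qed.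

Lemma primes_pfactor p k m : prime p -> (0 < k)%N -> ~~ (p %| m)%N -> (0 < m)%N ->
  perm_eq (primes (p ^ k * m)%N) (p :: primes m).
Proof.
move=> p_pr k0 pm m0; have p0 := prime_gt0 p_pr.
apply: uniq_perm; rewrite ?primes_uniq //=.
  by rewrite primes_uniq mem_primes (negPf pm) !andbF.
by move=> q; rewrite primesM ?expn_gt0 ?p0 // primesX // primes_prime // !inE.
Qed.

Lemma mangoldt_pfactor p k m : prime p -> ~~ (p %| m)%N -> (0 < m)%N ->
  mangoldt (p ^ k.+1 * m)%N = if m == 1%N then lnn p else 0.
Proof.
move=> p_pr pm m0; rewrite /mangoldt.
rewrite (perm_size (primes_pfactor p_pr _ pm m0)) //= eqSS size_eq0.
case: m pm m0 => [|[|m]] // _ _; first by rewrite /= muln1 pdiv_pfactor.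
by case: eqP => // /eqP; rewrite primes_eq0.
Qed.

Lemma mangoldt1 : mangoldt 1 = 0.
Proof. by []. Qed.

Lemma sum_mangoldt n : (0 < n)%N -> \sum_(d <- divisors n) mangoldt d = lnn n.
Proof.
elim/pfactor_ind: n / => [|p k m p_pr k0 pm m0 IHm].
  by rewrite big_seq1 lnn1.
have p0 := prime_gt0 p_pr.
rewrite sum_divisors_pfactor // big_ord_recl /=.
under eq_bigr do rewrite expn0 mul1n.
rewrite IHm (eq_bigr (fun=> lnn p)) => [|i _].
  by rewrite sumr_const card_ord lnnM ?expn_gt0 ?p0 // lnnX // addrC.
rewrite (eq_big_seq (fun d => if d == 1%N then lnn p else 0)) => [|d].
  by rewrite -big_mkcond -big_filter filter_pred1_uniq ?divisors_uniq ?divisor1 // big_seq1.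
rewrite -dvdn_divisors // => dm; rewrite /bump leq0n add1n mangoldt_pfactor ?(dvdn_gt0 m0) //.
by apply: contra pm => /dvdn_trans; apply.
Qed.

Lemma moebius1 : moebius 1 = 1.
Proof. by rewrite /moebius big_nil. Qed.

Lemma moebius_pfactor p k m : prime p -> (0 < k)%N -> ~~ (p %| m)%N -> (0 < m)%N ->
  moebius (p ^ k * m)%N = (if k == 1%N then - moebius m else 0).
Proof.
move=> p_pr k0 pm m0; have p0 := prime_gt0 p_pr.
rewrite /moebius (perm_big _ (primes_pfactor p_pr k0 pm m0)) big_cons.
have -> : logn p (p ^ k * m)%N = k.
  by rewrite lognM ?expn_gt0 ?p0 // pfactorK // (lognE p m) p_pr m0 (negPf pm) addn0.
case: (k == 1%N) => /=; last by rewrite mul0r.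
rewrite mulN1r; congr (- _); apply: eq_big_seq => q; rewrite mem_primes => /and3P[q_pr _ qm].
rewrite lognM ?expn_gt0 ?p0 // lognX (logn_prime _ p_pr).
by case: (q =P p) => [qp|_]; [rewrite -qp qm in pm | rewrite muln0].
Qed.

Lemma moebius_bound n : (0 < n)%N -> `|moebius n| <= 1.
Proof.
elim/pfactor_ind: n / => [|p k m p_pr k0 pm m0 IHm].
  by rewrite moebius1 normr1.
by rewrite moebius_pfactor //; case: ifP => _; rewrite ?normrN ?normr0.
Qed.

(** Only the exponents 0 and 1 of [p] contribute, with opposite signs. *)
Lemma sum_moebius_pfactor p k m (F : nat -> R) :
  prime p -> (0 < k)%N -> ~~ (p %| m)%N -> (0 < m)%N ->
  \sum_(d <- divisors (p ^ k * m)%N) moebius d * F d =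
  \sum_(d <- divisors m) moebius d * (F d - F (p * d)%N).
Proof.
move=> p_pr k0 pm m0; rewrite sum_divisors_pfactor //; case: k k0 => // k _.
have pd d : d \in divisors m -> ~~ (p %| d)%N /\ (0 < d)%N.
  rewrite -dvdn_divisors // => dm; split; last exact: dvdn_gt0 dm.
  by apply: contra pm => /dvdn_trans; apply.
rewrite !big_ord_recl [X in _ + (_ + X)]big1 ?addr0 => [|i _]; last first.
  by rewrite big_seq big1 // => d /pd[? ?]; rewrite !lift0 moebius_pfactor // mul0r.
rewrite -big_split /=; apply: eq_big_seq => d /pd[? ?].
by rewrite /bump /= expn0 mul1n moebius_pfactor //= expn1 mulrBr mulNr.
Qed.

Lemma sum_moebius n : (0 < n)%N ->
  \sum_(d <- divisors n) moebius d = (n == 1%N)%:R.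
Proof.
elim/pfactor_ind: n / => [|p k m p_pr k0 pm m0 IHm].
  by rewrite big_seq1 moebius1.
under eq_bigr do rewrite -[moebius _]mulr1.
rewrite (sum_moebius_pfactor (fun=> 1)) // big1 => [|d _]; last by rewrite subrr mulr0.
by rewrite muln_eq1 gtn_eqF // -(expn0 p) ltn_exp2l ?prime_gt1.
Qed.

(** Splitting off a prime [p] replaces [ln d] by [ln d - ln (p d) = - ln p], a constant; what
    remains is the plain Moebius sum over the cofactor, which vanishes unless the cofactor is 1. *)
Lemma sum_moebius_ln n : (0 < n)%N ->
  \sum_(d <- divisors n) moebius d * lnn d = - mangoldt n.
Proof.
elim/pfactor_ind: n / => [|p k m p_pr k0 pm m0 _].
  by rewrite big_seq1 moebius1 lnn1 mangoldt1 mulr0 oppr0.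
rewrite sum_moebius_pfactor //.
rewrite (eq_big_seq (fun d => - lnn p * moebius d)) => [|d].
  rewrite -mulr_sumr sum_moebius //; case: k k0 => // k _.
  by rewrite mangoldt_pfactor //; case: eqP; rewrite ?mulr1 ?mulr0 ?oppr0.
rewrite -dvdn_divisors // => dm; rewrite lnnM ?(prime_gt0 p_pr) ?(dvdn_gt0 m0 dm) //.
by ring.
Qed.

End ArithmeticFunctions.

(** * Chebyshev's and Mertens' estimates *)

Section Estimates.

Local Open Scope ring_scope.
Variable R : realType.
Implicit Types (n m x p k d : nat).

Notation lnn := (@lnn R).
Notation mangoldt := (@mangoldt R).

Lemma lnnS_le n : (0 < n)%N -> lnn n.+1 <= lnn n + n%:R^-1.
Proof.
move=> n0; have n0' : 0 < n%:R :> R by rewrite ltr0n.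
have -> : lnn n.+1 = lnn n + ln (1 + n%:R^-1).
  rewrite /lnn -lnM ?posrE ?addr_gt0 ?invr_gt0 //.
  by rewrite mulrDr mulr1 divff ?gt_eqF // -natr1.
rewrite lerD2l le_ln1Dx //; apply: lt_trans (_ : 0 < _); first lra.
by rewrite invr_gt0.
Qed.

Lemma lnn_fact_sum x : lnn x`! = \sum_(1 <= d < x.+1) lnn d.
Proof.
elim: x => [|x IHx]; first by rewrite big_geq // lnn1.
by rewrite big_nat_recr //= factS lnnM ?fact_gt0 // IHx addrC.
Qed.

(** A weak Stirling bound; the induction step amounts to [n (ln (n + 1) - ln n) <= 1]. *)
Lemma lnn_fact_ge x : x%:R * lnn x - x%:R <= lnn x`!.
Proof.
elim: x => [|x IHx]; first by rewrite mul0r subrr lnn1.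
rewrite factS lnnM ?fact_gt0 //.
case: x IHx => [|x] IHx; first by rewrite lnn1; lra.
have x0 : 0 < x.+1%:R :> R by rewrite ltr0n.
have := lnnS_le (ltn0Sn x); rewrite -(ler_pM2l x0) mulrDr divff ?gt_eqF //.
rewrite -[x.+2%:R]natr1; nra.
Qed.

Lemma lnn_fact_le x : lnn x`! <= x%:R * lnn x.
Proof.
rewrite lnn_fact_sum; have -> : x%:R * lnn x = \sum_(1 <= d < x.+1) lnn x.
  by rewrite sumr_const_nat subn1 mulr_natl.
by apply: ler_sum_nat => d /andP[_ dx]; rewrite ler_lnn // -ltnS.
Qed.

(** Sum [ln = 1 * Lambda] up to [x]: the integer [d] has [x %/ d] multiples there. *)
Lemma lnn_fact_mangoldt x :
  lnn x`! = \sum_(1 <= d < x.+1) mangoldt d * (x %/ d)%:R.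
Proof.
rewrite lnn_fact_sum.
rewrite (eq_big_nat _ _ (F2 := fun n => \sum_(d <- divisors n) mangoldt d)); last first.
  by move=> n /andP[n0 _]; rewrite sum_mangoldt.
rewrite (sum_divisors_swap x (fun d _ => mangoldt d)).
by apply: eq_big_nat => d _; rewrite sumr_const_nat subn1 mulr_natr.
Qed.

Definition psi x := \sum_(1 <= d < x.+1) mangoldt d.

Lemma ler_psi x y : (x <= y)%N -> psi x <= psi y.
Proof.
move=> xy; rewrite /psi [leRHS](big_cat_nat (n := x.+1)) //= lerDl.
by rewrite big_seq sumr_ge0 // => d _; rewrite mangoldt_ge0.
Qed.

(** Chebyshev's argument: in the logarithm of the central binomial coefficient, [Lambda d] has
    coefficient [2n %/ d - 2 (n %/ d)], which is nonnegative, and at least 1 for [n < d <= 2n]. The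
    coefficient itself is at most [2 ^ 2n], and [ln 2 <= 1]. *)
Lemma psi_double n : psi n.*2 <= psi n + n.*2%:R.
Proof.
have le_psi : psi n.*2 - psi n <= lnn n.*2`! - (lnn n`! + lnn n`!).
  have n2 : (n <= n.*2)%N by rewrite -addnn leq_addr.
  have -> : lnn n`! = \sum_(1 <= d < n.*2.+1) mangoldt d * (n %/ d)%:R.
    rewrite lnn_fact_mangoldt [RHS](big_cat_nat (n := n.+1)) //=.
    rewrite [X in _ + X]big_nat_cond [X in _ + X]big1 ?addr0 // => d /andP[/andP[nd _] _].
    by rewrite divn_small ?mulr0.
  rewrite lnn_fact_mangoldt -big_split -sumrB /=.
  rewrite (big_cat_nat (n := n.+1)) //= [psi n.*2](big_cat_nat (n := n.+1)) //=.
  rewrite /psi [X in X - _]addrC addrK -[X in X <= _]add0r lerD //.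
    rewrite big_nat_cond sumr_ge0 // => d /andP[/andP[d0 _] _].
    rewrite -mulrDr -mulrBr mulr_ge0 ?mangoldt_ge0 // -natrD subr_ge0 ler_nat.
    by rewrite leq_divRL // mulnDl -addnn leq_add ?leq_trunc_div.
  apply: ler_sum_nat => d /andP[nd dn].
  rewrite -mulrDr -mulrBr ler_peMr ?mangoldt_ge0 //.
  rewrite (divn_small nd) addr0 subr0 ler1n divn_gt0 //.
  by apply: leq_ltn_trans nd.
rewrite -lerBlDl; apply: le_trans le_psi _.
have C0 : (0 < 'C(n.*2, n))%N by rewrite bin_gt0 -addnn leq_addr.
have n2 : (n <= n.*2)%N by rewrite -addnn leq_addr.
have := congr1 lnn (bin_fact n2); rewrite -{2}addnn addnK !lnnM ?muln_gt0 ?fact_gt0 // => <-.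
rewrite addrK; apply: le_trans (_ : lnn (2 ^ n.*2) <= _).
  rewrite ler_lnn // -[2%N]/((1 + 1)%N) expnDn.
  have n_lt : (n < n.*2.+1)%N by rewrite ltnS -addnn leq_addr.
  by rewrite (bigD1 (Ordinal n_lt)) //= !exp1n !muln1 leq_addr.
rewrite lnnX // -[lnn 2 *+ _]mulr_natl ler_piMr //.
have := lnnS_le (ltn0Sn 0); rewrite lnn1; lra.
Qed.

Lemma psi_le n : psi n <= 4 * n%:R.
Proof.
elim/ltn_ind: n => n IHn.
have [|n_gt1] := leqP n 1.
  case: n IHn => [|[]] // _ _; rewrite /psi; first by rewrite big_geq // mulr0.
  by rewrite big_nat1 mangoldt1 mulr1; lra.
have le1 : (n <= (uphalf n).*2)%N by lia.
have lt1 : (uphalf n < n)%N by lia.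
apply: le_trans (ler_psi le1) _; apply: le_trans (psi_double _) _.
have := IHn _ lt1.
(* Doubling from [uphalf n] gives the bound [(4 + 2) * uphalf n]. The inequality holds from [n = 2]
   on, with equality at 3; hence the constant 4. *)
have h : (uphalf n * 6 <= n * 4)%N by lia.
move: h; rewrite -(ler_nat R) !natrM -muln2 natrM; lra.
Qed.

Definition bdd (u : nat -> R) := exists C, forall x, `|u x| <= C.

Lemma bddD u v : bdd u -> bdd v -> bdd (fun x => u x + v x).
Proof.
move=> [C uC] [D vD]; exists (C + D) => x.
by apply: le_trans (ler_normD _ _) _; rewrite lerD.
Qed.

Lemma bddN u : bdd u -> bdd (fun x => - u x).
Proof. by move=> [C uC]; exists C => x; rewrite normrN. Qed.

Lemma bddB u v : bdd u -> bdd v -> bdd (fun x => u x - v x).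
Proof. by move=> ub vb; apply: bddD => //; apply: bddN. Qed.

Lemma bddZ a u : bdd u -> bdd (fun x => a * u x).
Proof. by move=> [C uC]; exists (`|a| * C) => x; rewrite normrM ler_wpM2l. Qed.

Lemma bdd0 : bdd (fun=> 0).
Proof. by exists 0 => x; rewrite normr0. Qed.

Lemma bdd_sum (I : Type) (r : seq I) (u : I -> nat -> R) :
  (forall i, bdd (u i)) -> bdd (fun x => \sum_(i <- r) u i x).
Proof.
move=> ub; elim: r => [|i r [C IHr]].
  by exists 0 => x; rewrite big_nil normr0.
have [D uD] := ub i; exists (D + C) => x; rewrite big_cons.
by apply: le_trans (ler_normD _ _) _; rewrite lerD.
Qed.

Lemma bdd_le u v : (forall x, `|u x| <= `|v x|) -> bdd v -> bdd u.
Proof. by move=> uv [C vC]; exists C => x; apply: le_trans (uv x) _. Qed.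

Lemma eq_bdd u v : u =1 v -> bdd v -> bdd u.
Proof. by move=> uv; apply: bdd_le => x; rewrite uv. Qed.

Lemma lnn_unbdd a : bdd (fun x => a * lnn x) -> a = 0.
Proof.
move=> [C aC]; have [//|a0] := eqVneq a 0; exfalso.
have C0 : 0 <= C by apply: le_trans (aC 0%N); rewrite normr_ge0.
have l2 : 0 < lnn 2 by rewrite ln_gt0 // ltr1n.
have [k kC] : exists k, C < k%:R * (`|a| * lnn 2).
  have a2 : 0 < `|a| * lnn 2 by rewrite mulr_gt0 ?normr_gt0.
  exists (Num.Def.archi_bound (C / (`|a| * lnn 2))).
  by rewrite -ltr_pdivrMr // archi_boundP // divr_ge0 // ltW.
have := aC (2 ^ k)%N; rewrite lnnX // -[lnn 2 *+ _]mulr_natl normrM (ger0_norm (_ : 0 <= _ * _)).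
  by rewrite mulrCA => /(lt_le_trans kC); rewrite ltxx.
by rewrite mulr_ge0 // ltW.
Qed.

(** Replacing [x %/ d] by [x / d] in the formula for [ln x!] costs at most [psi x <= 4 x], and
    [ln x!] lies between [x ln x - x] and [x ln x]. Divide by [x]. *)
Lemma mertens : bdd (fun x => \sum_(1 <= d < x.+1) mangoldt d / d%:R - lnn x).
Proof.
exists 4 => x; case: x => [|x].
  by rewrite big_geq // /lnn ln0 // subrr normr0; lra.
have x0 : 0 < x.+1%:R :> R by rewrite ltr0n.
set s := \sum_(_ <= _ < _) _.
have lo : lnn x.+1`! <= x.+1%:R * s.
  rewrite lnn_fact_mangoldt mulr_sumr; apply: ler_sum_nat => d /andP[d0 _].
  rewrite mulrCA ler_wpM2l ?mangoldt_ge0 // ler_pdivlMr ?ltr0n // -natrM ler_nat.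
  exact: leq_trunc_div.
have hi : x.+1%:R * s <= lnn x.+1`! + psi x.+1.
  rewrite /s mulr_sumr lnn_fact_mangoldt /psi -big_split /=; apply: ler_sum_nat => d /andP[d0 _].
  rewrite mulrCA -[X in _ + X]mulr1 -mulrDr ler_wpM2l ?mangoldt_ge0 //.
  rewrite ler_pdivrMr ?ltr0n // natr1 -natrM ler_nat.
  by rewrite ltnW // ltn_ceil.
have := lnn_fact_ge x.+1; have := lnn_fact_le x.+1; have := psi_le x.+1.
move=> h1 h2 h3; rewrite ler_norml; apply/andP; split.
  by rewrite -(ler_pM2l x0); nra.
by rewrite -(ler_pM2l x0); nra.
Qed.

(* Unlike [ln n / n], this is nonincreasing from [n = 1] on. *)
Definition lnn2_div n : R := (lnn n + 2) / n%:R.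

Lemma lnn2_divB n : (0 < n)%N ->
  (lnn n + 1) / (n%:R * n.+1%:R) <= lnn2_div n - lnn2_div n.+1.
Proof.
move=> n0; rewrite /lnn2_div; have n0' : 0 < n%:R :> R by rewrite ltr0n.
have := lnnS_le n0; rewrite -(ler_pM2l n0') mulrDr divff ?gt_eqF // => h.
rewrite -subr_ge0 -[n.+1%:R]natr1.
rewrite [X in 0 <= X](_ : _ = (n%:R * lnn n + 1 - n%:R * lnn n.+1) / (n%:R * (n%:R + 1))).
  by apply: divr_ge0; [lra | apply: mulr_ge0; lra].
by field; lra.
Qed.

(** Each term is at most twice the decrement of [lnn2_div] at [d], so the sum telescopes, and
    [lnn2_div 1 = 2]. *)
Lemma sum_lnn_sqr_le x : \sum_(1 <= d < x.+1) lnn d / d%:R ^+ 2 <= 4.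
Proof.
have : \sum_(1 <= d < x.+1) lnn d / d%:R ^+ 2 <= 2 * (lnn2_div 1 - lnn2_div x.+1).
  rewrite -opprB -(telescope_sumr lnn2_div) // -sumrN mulr_sumr.
  apply: ler_sum_nat => d /andP[d0 _]; rewrite opprB.
  apply: le_trans (_ : 2 * ((lnn d + 1) / (d%:R * d.+1%:R)) <= _); last first.
    by rewrite ler_wpM2l // lnn2_divB.
  have d0' : 1 <= d%:R :> R by rewrite ler1n.
  rewrite mulrA ler_pdivrMr ?exprn_gt0 ?ltr0n // mulrAC ler_pdivlMr ?mulr_gt0 ?ltr0n //.
  have := lnn_ge0 R d; rewrite -[d.+1%:R]natr1; move: (lnn d) (d%:R) d0' => a b hb ha.
  rewrite [X in _ <= X](_ : _ = 2 * (a + 1) * b * b); last ring.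
  rewrite [X in X <= _](_ : _ = a * (b + 1) * b); last ring.
  by rewrite ler_wpM2r //; nra.
have -> : lnn2_div 1 = 2 by rewrite /lnn2_div lnn1; lra.
have : 0 <= lnn2_div x.+1 by rewrite divr_ge0 // addr_ge0 // lnn_ge0.
lra.
Qed.

End Estimates.

(** * Higher prime powers and Mertens' estimate over units *)

Section PrimePowers.

Local Open Scope ring_scope.
Variable R : realType.
Implicit Types (n m x p k d : nat).

Notation lnn := (@lnn R).
Notation mangoldt := (@mangoldt R).

(** For prime [d] this is [1 / m] on the powers of [d], including 1: its sum is a geometric series,
    written over all [m] so that divisor sums apply. *)
Definition pnat_inv d m : R := if d.-nat m then m%:R^-1 else 0.

Lemma pnat_inv_ge0 d m : 0 <= pnat_inv d m.
Proof. by rewrite /pnat_inv; case: ifP => // _; rewrite invr_ge0. Qed.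

Lemma pnat_invM d m : prime d -> (0 < m)%N ->
  pnat_inv d (d * m) = d%:R^-1 * pnat_inv d m.
Proof.
move=> d_pr m0; rewrite /pnat_inv pnatM pnat_id //=; case: ifP; rewrite ?mulr0 // => _.
by rewrite natrM invfM.
Qed.

Lemma sum_pnat_inv_dvd d x : prime d ->
  \sum_(1 <= m < x.+1 | (d %| m)%N) pnat_inv d m =
  d%:R^-1 * \sum_(1 <= m < (x %/ d).+1) pnat_inv d m.
Proof.
move=> d_pr; have d0 := prime_gt0 d_pr.
rewrite mulr_sumr -(sum_multiples x (fun m => d%:R^-1 * pnat_inv d m)) //.
rewrite big_nat_cond [RHS]big_nat_cond.
apply: eq_bigr => m /andP[/andP[m0 _] /dvdnP[q mE]]; rewrite mE mulnK // mulnC.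
by rewrite pnat_invM //; case: q mE => // mE; rewrite mE in m0.
Qed.

(** Self-similarity: apart from [m = 1], only multiples of [d] occur, and they contribute [1 / d]
    times the sum up to [x %/ d]. So 2 is reproduced as [1 + 2 / 2]. *)
Lemma sum_pnat_inv_le d x : prime d -> \sum_(1 <= m < x.+1) pnat_inv d m <= 2.
Proof.
move=> d_pr; have d1 := prime_gt1 d_pr; elim/ltn_ind: x => x IHx.
case: x IHx => [|x] IHx; first by rewrite big_geq.
have lt_xd : (x.+1 %/ d < x.+1)%N by rewrite ltn_Pdiv.
apply: le_trans (_ : \sum_(1 <= m < x.+2) (m == 1%N)%:R +
  \sum_(1 <= m < x.+2 | (d %| m)%N) pnat_inv d m <= _).
  rewrite [X in _ + X]big_mkcond -big_split /=; apply: ler_sum_nat => m /andP[m0 _].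
  case: ifP => dm; first by rewrite lerDr.
  have [->|m1] := eqVneq m 1%N; first by rewrite /pnat_inv /= invr1 addr0.
  rewrite /pnat_inv; case: ifP => [/andP[_ /allP dP]|_]; last by rewrite addr0.
  have m_gt1 : (1 < m)%N by rewrite ltn_neqAle eq_sym m1.
  have := dP (pdiv m); rewrite mem_primes pdiv_prime // m0 pdiv_dvd => /(_ isT).
  by rewrite inE => /eqP dE; rewrite -dE pdiv_dvd in dm.
rewrite big_nat_recl // big_nat big1 ?addr0 => [|m /andP[m0 _]]; last first.
  by case: m m0.
rewrite sum_pnat_inv_dvd //.
have := IHx _ lt_xd; set s := \sum_(_ <= _ < _) _ => s2.
have s0 : 0 <= s by apply: sumr_ge0 => m _; rewrite pnat_inv_ge0.
have d2 : d%:R^-1 <= 2^-1 :> R by rewrite lef_pV2 ?posrE ?ltr0n ?ler_nat // ltnW.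
rewrite /= -[2]/(1 + 1) lerD2l; apply: le_trans (_ : 2^-1 * 2 <= _); last by lra.
by rewrite ler_pM // invr_ge0.
Qed.

Lemma sum_mangoldt_nonprime_le x :
  \sum_(1 <= n < x.+1) (if prime n then 0 else mangoldt n / n%:R) <= 8.
Proof.
(* A power [p ^ k] with [k >= 2] is counted as [d = p] times [m = p ^ (k - 1)]. For fixed [d] the
   sum over [m] is at most [2 ln d / d ^ 2]. *)
pose F d m := if prime d && (d %| m)%N then lnn d / d%:R * pnat_inv d m else 0.
have F0 d m : 0 <= F d m.
  rewrite /F; case: ifP => // _.
  by rewrite mulr_ge0 ?pnat_inv_ge0 // divr_ge0 // lnn_ge0.
apply: le_trans (_ : \sum_(1 <= n < x.+1) \sum_(d <- divisors n) F d (n %/ d)%N <= _).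
  apply: ler_sum_nat => n /andP[n0 _].
  have S0 : 0 <= \sum_(d <- divisors n) F d (n %/ d)%N by apply: sumr_ge0.
  case: ifP => // /negbT; move: n0 S0; elim/pfactor_ind: n / => [|p k m p_pr k0 pm m0 _].
    by rewrite mangoldt1 mul0r.
  case: k k0 => // k _; rewrite mangoldt_pfactor //.
  case: eqP => [->|_] S0 npr; last by rewrite mul0r.
  rewrite !muln1 in npr S0 *; case: k npr S0 => [|k] npr S0.
    by rewrite expn1 p_pr in npr.
  have p0 := prime_gt0 p_pr.
  rewrite (bigD1_seq p) ?divisors_uniq -?dvdn_divisors ?expn_gt0 ?p0 ?dvdn_exp //=.
  rewrite -[X in X <= _]addr0 lerD ?sumr_ge0 //.
  rewrite expnS mulKn // /F p_pr dvdn_exp //= /pnat_inv pnatX pnat_id //.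
  by rewrite natrM invfM mulrA.
rewrite sum_divisors_swap.
apply: le_trans (_ : \sum_(1 <= d < x.+1) 2 * (lnn d / d%:R ^+ 2) <= _); last first.
  by rewrite -mulr_sumr; have := sum_lnn_sqr_le R x; lra.
apply: ler_sum_nat => d /andP[d0 _]; rewrite /F.
have l0 : 0 <= lnn d / d%:R ^+ 2 by rewrite divr_ge0 ?lnn_ge0 // exprn_ge0.
case: (boolP (prime d)) => [d_pr|_] /=; last by rewrite big1 // mulr_ge0.
rewrite -big_mkcond -mulr_sumr sum_pnat_inv_dvd // [leLHS]mulrA [leRHS]mulrC.
have -> : lnn d / d%:R / d%:R = lnn d / d%:R ^+ 2 by rewrite expr2 invfM mulrA.
by rewrite ler_wpM2l // sum_pnat_inv_le.
Qed.

(** Compare with [mertens]: among the terms removed, the nonprimes contribute at most 8, and the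
    primes divide [N], hence are at most [N]. *)
Lemma mertens_coprime N : (0 < N)%N ->
  bdd (fun x => \sum_(1 <= d < x.+1) mangoldt d / d%:R * (coprime d N)%:R - lnn x).
Proof.
move=> N0; case: (mertens R) => C hC.
have T0 n : 0 <= mangoldt n / n%:R by rewrite divr_ge0 ?mangoldt_ge0.
exists (C + (8 + \sum_(1 <= n < N.+1) mangoldt n / n%:R)) => x.
have -> : \sum_(1 <= d < x.+1) mangoldt d / d%:R * (coprime d N)%:R =
  \sum_(1 <= d < x.+1) mangoldt d / d%:R -
  \sum_(1 <= d < x.+1) (if coprime d N then 0 else mangoldt d / d%:R).
  rewrite -sumrB; apply: eq_bigr => d _.
  by case: ifP => _; rewrite ?mulr1 ?subr0 ?mulr0 ?subrr.
rewrite addrAC; apply: le_trans (ler_normB _ _) _; rewrite lerD // ger0_norm; last first.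
  by apply: sumr_ge0 => d _; case: ifP.
have le_N : \sum_(1 <= d < x.+1) (if (d <= N)%N then mangoldt d / d%:R else 0) <=
    \sum_(1 <= n < N.+1) mangoldt n / n%:R.
  have [xN|Nx] := leqP x N.
    rewrite [leRHS](big_cat_nat (n := x.+1)) //= -[leLHS]addr0 lerD ?sumr_ge0 //.
    by apply: ler_sum_nat => d _; case: ifP.
  rewrite (big_cat_nat (n := N.+1)) //=; last by rewrite ltnW.
  rewrite [X in _ + X]big_nat_cond [X in _ + X]big1 ?addr0 => [|d /andP[/andP[Nd _] _]].
    by apply: ler_sum_nat => d _; case: ifP.
  by rewrite leqNgt Nd.
apply: le_trans (lerD (sum_mangoldt_nonprime_le x) le_N).
rewrite -big_split /=; apply: ler_sum_nat => d /andP[d0 _].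
case: ifP => [_|/negbT ndN]; first by rewrite addr_ge0 //; case: ifP.
case: (boolP (prime d)) => [d_pr|_]; last by rewrite lerDl; case: ifP.
by rewrite prime_coprime // negbK in ndN; rewrite dvdn_leq // add0r.
Qed.

End PrimePowers.

(** * Mean-zero functions on the units and their L-values *)

Section Convergence.

Local Open Scope ring_scope.
Variable R : realType.
Implicit Types (n m x y p k d g h : nat) (a b f : nat -> R).

(** Summation by parts. The case [m = x] is an empty sum, for which nothing is known about the sign
    of [b m.+1]. *)
Lemma abel_bound a b (B : R) m x : (m <= x)%N ->
  (forall n, `|\sum_(1 <= k < n.+1) a k| <= B) ->
  (forall n, (m < n)%N -> (n < x)%N -> b n.+1 <= b n) ->
  (forall n, (m < n)%N -> (n <= x)%N -> 0 <= b n) ->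
  `|\sum_(m.+1 <= n < x.+1) a n * b n| <= (if (m < x)%N then 2 * B * b m.+1 else 0).
Proof.
move=> mx aB; pose S n := \sum_(1 <= k < n.+1) a k.
have SS n : S n.+1 = S n + a n.+1 by rewrite /S big_nat_recr.
have B0 : 0 <= B by apply: le_trans (aB 0%N); rewrite normr_ge0.
have {mx}[d ->] : exists d, x = (m + d)%N by exists (x - m)%N; rewrite subnKC.
move=> b_dec b_ge0; case: d b_dec b_ge0 => [|d] b_dec b_ge0.
  by rewrite addn0 big_geq // normr0 ltnn.
rewrite -addSnnS leq_addr in b_dec b_ge0 *.
set s := \sum_(_ <= _ < _) _.
(* Keeping the boundary term apart makes the induction on the length telescope. *)
suff h : `|s - S (m.+1 + d)%N * b (m.+1 + d)%N| <= B * (2 * b m.+1 - b (m.+1 + d)%N).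
  have b0 : 0 <= b (m.+1 + d)%N by apply: b_ge0; lia.
  have Sb : `|S (m.+1 + d)%N * b (m.+1 + d)%N| <= B * b (m.+1 + d)%N.
    by rewrite normrM (ger0_norm b0) ler_wpM2r // aB.
  rewrite -[s](subrK (S (m.+1 + d)%N * b (m.+1 + d)%N)).
  by apply: le_trans (ler_normD _ _) _; apply: le_trans (lerD h Sb) _; lra.
rewrite {}/s; elim: d b_dec b_ge0 => [|d IHd] b_dec b_ge0.
  rewrite addn0 big_nat1 SS -mulrBl opprD addrCA subrr addr0 normrM normrN.
  have b0 : 0 <= b m.+1 by apply: b_ge0; lia.
  rewrite (ger0_norm b0) [leRHS](_ : _ = B * b m.+1); last ring.
  by rewrite ler_wpM2r // aB.
have {}IHd : `|\sum_(m.+1 <= n < (m.+1 + d).+1) a n * b n - S (m.+1 + d)%N * b (m.+1 + d)%N| <=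
    B * (2 * b m.+1 - b (m.+1 + d)%N).
  apply: IHd => n mn nd; first by apply: b_dec => //; lia.
  by apply: b_ge0 => //; lia.
rewrite big_nat_recr /=; last by lia.
have db : b (m.+1 + d).+1 <= b (m.+1 + d)%N by apply: b_dec; lia.
rewrite !addnS; set s := \sum_(_ <= _ < _) _ in IHd *.
have -> : s + a (m.+1 + d).+1 * b (m.+1 + d).+1 - S (m.+1 + d).+1 * b (m.+1 + d).+1 =
  s - S (m.+1 + d)%N * b (m.+1 + d)%N + S (m.+1 + d)%N * (b (m.+1 + d)%N - b (m.+1 + d).+1).
  by rewrite SS; ring.
apply: le_trans (ler_normD _ _) _.
have Sb : `|S (m.+1 + d)%N * (b (m.+1 + d)%N - b (m.+1 + d).+1)| <=
    B * (b (m.+1 + d)%N - b (m.+1 + d).+1).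
  by rewrite normrM (@ger0_norm _ (b _ - _)) ?subr_ge0 // ler_wpM2r ?subr_ge0 // aB.
by apply: le_trans (lerD IHd Sb) _; lra.
Qed.

(** The limit is the supremum of the lower bounds [u x - C / (x + 1)]; every [u y + C / (y + 1)] is
    an upper bound for all of them. *)
Lemma cvg_rate_ex (u : nat -> R) (C : R) :
  (forall x y, (x <= y)%N -> `|u y - u x| <= C / x.+1%:R) ->
  exists c, forall x, `|u x - c| <= C / x.+1%:R.
Proof.
move=> uC; have C0 : 0 <= C.
  have := uC 0%N 0%N (leqnn _); rewrite invr1 mulr1; apply: le_trans.
  by rewrite normr_ge0.
pose T := [set z | exists x, z = u x - C / x.+1%:R]%classic.
have C1 z : 0 <= C / z.+1%:R by rewrite divr_ge0.
have Tub x : ubound T (u x + C / x.+1%:R).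
  move=> _ [y ->]; have [xy|/ltnW yx] := leqP x y.
    have := uC _ _ xy; have := C1 y; rewrite ler_norml.
    by move: (C / _) (C / _) => cx cy ? /andP[? ?]; lra.
  have := uC _ _ yx; have := C1 x; rewrite ler_norml.
  by move: (C / _) (C / _) => cx cy ? /andP[? ?]; lra.
have T0 : T (u 0%N - C / 1%:R) by exists 0%N.
exists (sup T) => x; rewrite ler_norml; apply/andP; split.
  have : sup T <= u x + C / x.+1%:R by apply: ge_sup => //; exists (u 0%N - C / 1%:R).
  by move: (C / _) => cx; lra.
have : u x - C / x.+1%:R <= sup T.
  by apply: ub_le_sup; [exists (u 0%N + C / 1%:R); apply: Tub | exists x].
by move: (C / _) => cx; lra.
Qed.

Lemma rate_eq0 (e C : R) : (forall x, `|e| <= C / x.+1%:R) -> e = 0.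
Proof.
move=> eC; have [//|e0] := eqVneq e 0; exfalso.
have e_gt0 : 0 < `|e| by rewrite normr_gt0.
have C0 : 0 <= C by have := eC 0%N; rewrite invr1 mulr1; apply: le_trans.
pose x := Num.Def.archi_bound (C / `|e|).
have : C / `|e| < x%:R by rewrite archi_boundP // divr_ge0.
rewrite ltr_pdivrMr // => Cx; have := eC x; rewrite ler_pdivlMr ?ltr0n // leNgt.
move=> /negP[]; apply: lt_le_trans Cx _; rewrite mulrC ler_wpM2l // ler_nat.
by rewrite leqnSn.
Qed.

Lemma cvg_rate_unique (u v : nat -> R) (c c' C C' : R) :
  (forall x, `|u x - c| <= C / x.+1%:R) -> (forall x, `|v x - c'| <= C' / x.+1%:R) ->
  (forall x, u x = v x) -> c = c'.
Proof.
move=> uc uc' uv; apply/eqP; rewrite -subr_eq0; apply/eqP.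
apply: (@rate_eq0 _ (C + C')) => x; rewrite mulrDl.
have := uc x; have := uc' x; rewrite uv !ler_norml.
move: (C / _) (C' / _) => r r' /andP[? ?] /andP[? ?].
by apply/andP; split; lra.
Qed.

End Convergence.

(** * L-values of mean-zero class functions *)

Section LSeries.

Local Open Scope ring_scope.
Variable R : realType.
Variable N : nat.
Hypothesis N_gt0 : (0 < N)%N.
Implicit Types (n m x y p k d g h : nat) (f ell : nat -> R).

Notation lnn := (@lnn R).
Notation mangoldt := (@mangoldt R).
Notation moebius := (@moebius R).

(* As [f] vanishes off the units modulo [N], [f (g * n)] vanishes unless [g] and
   [n] are coprime to [N]: no principal character is needed. *)
Definition classfun f :=
  (forall n, f (n %% N)%N = f n) /\ (forall n, ~~ coprime n N -> f n = 0).

Definition classfun0 f := classfun f /\ \sum_(0 <= i < N) f i = 0.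

Lemma classfun_shift f g : classfun f -> classfun (fun n => f (g * n)%N).
Proof.
move=> [fM f0]; split=> n; first by rewrite -fM modnMmr fM.
by move=> nN; rewrite f0 // coprimeMl negb_and nN orbT.
Qed.

Lemma classfun_eq f m n : classfun f -> m = n %[mod N] -> f m = f n.
Proof. by case=> fM _ mn; rewrite -fM mn fM. Qed.

(** Multiplication by a unit permutes the residues; for a nonunit [g] all terms vanish. *)
Lemma classfun_shift_sum f g : classfun f ->
  \sum_(0 <= i < N) f (g * i)%N = (coprime g N)%:R * \sum_(0 <= i < N) f i.
Proof.
move=> fc; have [fM f0] := fc; case: (boolP (coprime g N)) => gN; last first.
  by rewrite mul0r big1 // => i _; rewrite f0 // coprimeMl negb_and gN.
rewrite mul1r !big_mkord; pose s (i : 'I_N) := Ordinal (ltn_pmod (g * i) N_gt0).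
have s_inj : injective s.
  have le_inj (i j : 'I_N) : (i <= j)%N -> s i = s j -> i = j.
    move=> ij /(congr1 val) /= /eqP; rewrite eq_sym eqn_mod_dvd ?leq_mul2l ?ij ?orbT //.
    rewrite -mulnBr Gauss_dvdr 1?coprime_sym // => Nij; apply/val_inj/eqP.
    rewrite eqn_leq ij /= -subn_eq0; apply: contraLR Nij => ij0.
    rewrite gtnNdvd ?lt0n //; apply: leq_ltn_trans (leq_subr _ _) (ltn_ord j).
  move=> i j sij; have [ij|/ltnW ji] := leqP i j; first exact: le_inj.
  by apply/esym/le_inj.
rewrite [RHS](reindex_inj s_inj) /=.
by apply: eq_bigr => i _; rewrite fM.
Qed.

Lemma classfun0_shift f g : classfun0 f -> classfun0 (fun n => f (g * n)%N).
Proof.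
move=> [fc fs]; split; first exact: classfun_shift.
by rewrite classfun_shift_sum // fs mulr0.
Qed.

Definition mass f : R := \sum_(0 <= i < N) `|f i|.

Lemma le_mass f n : classfun f -> `|f n| <= mass f.
Proof.
move=> [fM _]; rewrite -fM /mass big_mkord.
rewrite (bigD1 (Ordinal (ltn_pmod n N_gt0))) //= lerDl.
by apply: sumr_ge0.
Qed.

Lemma mass_ge0 f : 0 <= mass f.
Proof. exact: sumr_ge0. Qed.

(** Full periods cancel, leaving fewer than [N] terms; one more [mass f] pays for the term at 0,
    which the sum omits. *)
Lemma partial_sum_le f g x : classfun0 f ->
  `|\sum_(1 <= n < x.+1) f (g * n)%N| <= (N.+1)%:R * mass f.
Proof.
move=> f0; have fc := f0.1.
suff H y : `|\sum_(0 <= n < y) f (g * n)%N| <= N%:R * mass f.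
  have := H x.+1; rewrite big_ltn // muln0; set s := \sum_(_ <= _ < _) _; rewrite -natr1 mulrDl mul1r => h.
  rewrite -[s](addKr (f 0%N)) addrC; apply: le_trans (ler_normD _ _) _.
  by rewrite normrN lerD // le_mass.
elim/ltn_ind: y => y IHy; have [yN|Ny] := ltnP y N.
  apply: le_trans (ler_norm_sum _ _ _) _.
  apply: le_trans (_ : \sum_(0 <= n < y) mass f <= _).
    by apply: ler_sum => i _; apply: le_mass.
  by rewrite sumr_const_nat subn0 -[mass f *+ _]mulr_natl ler_wpM2r ?mass_ge0 // ler_nat ltnW.
rewrite (big_cat_nat (n := N)) //= (classfun0_shift g f0).2 add0r.
rewrite -{1}[N]add0n big_addn.
rewrite (eq_bigr (fun n => f (g * n)%N)) => [|n _]; last first.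
  by apply: classfun_eq => //; rewrite mulnDr addnC modnMDl.
by apply: IHy; rewrite ltn_subrL N_gt0 (leq_trans N_gt0).
Qed.

Definition Lsum f x g : R := \sum_(1 <= n < x.+1) f (g * n)%N / n%:R.

(** The rate is uniform in [g] and part of the notion: in convolutions [Lsum] is taken at [x %/ d]
    and shift [g * d], and these errors are summed over [d]. *)
Definition is_Lval f (C : R) ell :=
  forall g x, `|Lsum f x g - ell g| <= C / x.+1%:R.

Lemma weighted_sum_le f g b m x : classfun0 f -> (m <= x)%N ->
  (forall n, (m < n)%N -> (n < x)%N -> b n.+1 <= b n) ->
  (forall n, (m < n)%N -> (n <= x)%N -> 0 <= b n) ->
  `|\sum_(m.+1 <= n < x.+1) f (g * n)%N * b n| <=
    if (m < x)%N then 2 * (N.+1%:R * mass f) * b m.+1 else 0.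
Proof. by move=> f0 mx; apply: abel_bound => // n; apply: partial_sum_le. Qed.

(** Summation by parts against [1 / n] bounds the tails by [O(1/x)]. *)
Lemma is_Lval_ex f : classfun0 f -> exists C ell, is_Lval f C ell.
Proof.
move=> f0; pose C := 2 * (N.+1%:R * mass f); exists C.
have C0 : 0 <= C by rewrite !mulr_ge0 ?mass_ge0.
suff /choice[ell ellP] : forall g, exists c, forall x, `|Lsum f x g - c| <= C / x.+1%:R.
  by exists ell.
move=> g; apply: cvg_rate_ex => x y xy.
rewrite /Lsum (big_cat_nat (n := x.+1)) //= addrAC subrr add0r.
apply: le_trans (weighted_sum_le (b := fun n => n%:R^-1) g f0 xy _ _) _.
- by move=> n xn _; rewrite lef_pV2 ?posrE ?ltr0n ?ler_nat // (leq_ltn_trans _ xn).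
- by move=> n _ _; rewrite invr_ge0.
by case: ifP => // _; rewrite divr_ge0.
Qed.

(** Each property already holds for [Lsum f x] and passes to the limit. *)
Lemma is_Lval_classfun f C ell : classfun0 f -> is_Lval f C ell -> classfun0 ell.
Proof.
move=> f0 fL; have fc := f0.1; have [fM fN] := fc; split; first split=> [n|n nN].
- apply: (cvg_rate_unique (fL _) (fL _)) => x; apply: eq_bigr => k _.
  by rewrite (classfun_eq (n := (n * k)%N) fc) // modnMml.
- apply: (@rate_eq0 _ _ C) => x; rewrite -normrN -[- _]add0r.
  rewrite [X in X - _](_ : 0 = Lsum f x n) ?fL // /Lsum big1 // => k _.
  by rewrite fN ?mul0r // coprimeMl negb_and nN.
apply: (@rate_eq0 _ _ (N%:R * C)) => x; rewrite -normrN -[- _]add0r.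
rewrite [X in X - _](_ : 0 = \sum_(0 <= i < N) Lsum f x i); last first.
  rewrite exchange_big_nat /= big1 // => k _; rewrite -mulr_suml.
  under eq_bigr do rewrite mulnC.
  by rewrite (classfun0_shift k f0).2 mul0r.
rewrite -sumrB; apply: le_trans (ler_norm_sum _ _ _) _.
apply: le_trans (_ : \sum_(0 <= i < N) C / x.+1%:R <= _).
  by apply: ler_sum => i _; apply: fL.
by rewrite sumr_const_nat subn0 -[_ / _ *+ _]mulr_natl mulrA.
Qed.

(** Write [ln n / n] as [lnn2_div n - 2 / n], a difference of two nonincreasing weights, and sum
    each by parts. *)
Lemma sum_lnn_bdd f g : classfun0 f ->
  bdd (fun x => \sum_(1 <= n < x.+1) f (g * n)%N * (lnn n / n%:R)).
Proof.
move=> f0; pose C := 2 * (N.+1%:R * mass f).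
have C0 : 0 <= C by rewrite !mulr_ge0 ?mass_ge0.
exists (C * lnn2_div R 1 + 2 * C) => x.
have -> : \sum_(1 <= n < x.+1) f (g * n)%N * (lnn n / n%:R) =
  \sum_(1 <= n < x.+1) f (g * n)%N * lnn2_div R n -
  2 * \sum_(1 <= n < x.+1) f (g * n)%N * n%:R^-1.
  rewrite mulr_sumr -sumrB; apply: eq_bigr => n _; rewrite /lnn2_div; ring.
apply: le_trans (ler_normB _ _) _; rewrite normrM (ger0_norm (_ : 0 <= 2)) //.
have l1 n : 0 <= lnn2_div R n by rewrite divr_ge0 // addr_ge0 // lnn_ge0.
apply: lerD; last rewrite ler_wpM2l //.
  apply: le_trans (weighted_sum_le (b := lnn2_div R) g f0 (leq0n x) _ _) _ => //.
    move=> n n0 _; rewrite -subr_ge0; apply: le_trans (lnn2_divB R n0).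
    by rewrite divr_ge0 ?addr_ge0 ?lnn_ge0 // mulr_ge0.
  by case: ifP => // _; rewrite mulr_ge0.
apply: le_trans (weighted_sum_le (b := fun n => n%:R^-1) g f0 (leq0n x) _ _) _.
- by move=> n n0 _; rewrite lef_pV2 ?posrE ?ltr0n ?ler_nat.
- by move=> n _ _; rewrite invr_ge0.
by case: ifP => // _; rewrite invr1 mulr1.
Qed.

(** With [n = d m], the factor [d] moves into the shift; this takes the place of the
    multiplicativity of a character. *)
Lemma sum_conv f u g x :
  \sum_(1 <= n < x.+1) f (g * n)%N * ((\sum_(d <- divisors n) u d) / n%:R) =
  \sum_(1 <= d < x.+1) u d / d%:R * Lsum f (x %/ d) (g * d).
Proof.
under [RHS]eq_bigr do rewrite mulr_sumr.
rewrite -(sum_divisors_swap x (fun d m => u d / d%:R * (f (g * d * m)%N / m%:R))).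
apply: eq_big_nat => n /andP[n0 _]; rewrite mulr_suml mulr_sumr.
apply: eq_big_seq => d; rewrite -dvdn_divisors // => dn.
rewrite -mulnA [(d * _)%N]mulnC divnK //.
have -> : n%:R = (n %/ d)%:R * d%:R :> R by rewrite -natrM divnK.
by rewrite invfM; ring.
Qed.

(** The error at [x %/ d] is at most [C d / x], and this [d] cancels the weight [1 / d]. *)
Lemma sum_conv_error f C ell u g x : is_Lval f C ell -> (0 < x)%N ->
  `|\sum_(1 <= d < x.+1) u d / d%:R * (Lsum f (x %/ d) (g * d) - ell (g * d)%N)| <=
  C / x%:R * \sum_(1 <= d < x.+1) `|u d|.
Proof.
move=> fL x0; have C0 : 0 <= C.
  by have := fL 0%N 0%N; rewrite invr1 mulr1; apply: le_trans.
apply: le_trans (ler_norm_sum _ _ _) _; rewrite mulr_sumr.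
apply: ler_sum_nat => d /andP[d0 _]; have dR : 0 < d%:R :> R by rewrite ltr0n.
rewrite !normrM normfV (ger0_norm (ltW dR)) -mulrA [leRHS]mulrC ler_wpM2l // mulrC.
apply: le_trans (ler_wpM2r _ (fL (g * d)%N (x %/ d)%N)) _.
  by rewrite invr_ge0 ltW.
rewrite -mulrA -invfM ler_wpM2l // lef_pV2 ?posrE ?mulr_gt0 ?ltr0n //.
by rewrite -natrM ler_nat ltnW // ltn_ceil.
Qed.

(** Take [u = Lambda] in [sum_conv]: the left side is the bounded sum with weights [ln n / n], and
    passing to the limits [ell] costs [C psi(x) / x]. *)
Lemma mangoldt_Lval_bdd f C ell g : classfun0 f -> is_Lval f C ell ->
  bdd (fun x => \sum_(1 <= d < x.+1) mangoldt d / d%:R * ell (g * d)%N).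
Proof.
move=> f0 fL; have C0 : 0 <= C.
  by have := fL 0%N 0%N; rewrite invr1 mulr1; apply: le_trans.
apply: (@eq_bdd _ _ (fun x => \sum_(1 <= n < x.+1) f (g * n)%N * (lnn n / n%:R) -
  \sum_(1 <= d < x.+1) mangoldt d / d%:R * (Lsum f (x %/ d) (g * d) - ell (g * d)%N))).
  move=> x; rewrite [X in _ = X - _](eq_big_nat _ _
    (F2 := fun n => f (g * n)%N * ((\sum_(d <- divisors n) mangoldt d) / n%:R))).
    by rewrite sum_conv -sumrB; apply: eq_bigr => d _; ring.
  by move=> n /andP[n0 _]; rewrite sum_mangoldt.
apply: bddB; first exact: sum_lnn_bdd.
exists (C * 4) => -[|x]; first by rewrite big_geq // normr0 mulr_ge0.
apply: le_trans (sum_conv_error _ _ fL _) _ => //.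
under eq_bigr do rewrite (ger0_norm (mangoldt_ge0 R _)).
rewrite -mulrA ler_wpM2l // mulrC ler_pdivrMr ?ltr0n //; exact: psi_le.
Qed.

(** Take [u d = mu(d) ln (x / d)] in [sum_conv]: its divisor sum is [Lambda n], plus [ln x] at
    [n = 1]. As the limits are 0, the whole sum is an error term, and the absolute values of [u] add
    up to at most [x ln x - ln x! <= x]. *)
Lemma mangoldt_Lval0_bdd f C g : classfun0 f -> is_Lval f C (fun=> 0) ->
  bdd (fun x => f g * lnn x + \sum_(1 <= n < x.+1) mangoldt n / n%:R * f (g * n)%N).
Proof.
move=> f0 fL; have C0 : 0 <= C.
  by have := fL 0%N 0%N; rewrite invr1 mulr1; apply: le_trans.
exists C => -[|x]; first by rewrite big_geq // /lnn ln0 // mulr0 addr0 normr0.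
pose u d := moebius d * (lnn x.+1 - lnn d).
have -> : f g * lnn x.+1 + \sum_(1 <= n < x.+2) mangoldt n / n%:R * f (g * n)%N =
  \sum_(1 <= d < x.+2) u d / d%:R * (Lsum f (x.+1 %/ d) (g * d) - 0).
  under [RHS]eq_bigr do rewrite subr0.
  rewrite -sum_conv [RHS](eq_big_nat _ _ (F2 := fun n =>
    f (g * n)%N * (n == 1%N)%:R * lnn x.+1 + mangoldt n / n%:R * f (g * n)%N)).
    rewrite big_split /=; congr (_ + _).
    rewrite big_ltn //= muln1 mulr1 big_nat big1 ?addr0 // => n /andP[n1 _].
    by rewrite gtn_eqF // mulr0 mul0r.
  move=> n /andP[n0 _]; rewrite /u; under eq_bigr do rewrite mulrBr.
  rewrite sumrB sum_moebius_ln // -mulr_suml sum_moebius // opprK.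
  case: (n =P 1%N) => [->|_]; first by rewrite /=; field.
  by rewrite mul0r mulr0 mul0r !add0r; ring.
apply: le_trans (sum_conv_error _ _ fL _) _ => //.
rewrite -mulrA -[leRHS]mulr1 ler_wpM2l // mulrC ler_pdivrMr ?ltr0n // mul1r.
apply: le_trans (_ : \sum_(1 <= d < x.+2) (lnn x.+1 - lnn d) <= _).
  apply: ler_sum_nat => d /andP[d0 dx]; rewrite normrM.
  rewrite (@ger0_norm _ (_ - _)) ?subr_ge0 ?ler_lnn //.
  by rewrite ler_piMl ?moebius_bound // subr_ge0 ler_lnn.
rewrite sumrB -lnn_fact_sum sumr_const_nat subn1 /= -[lnn _ *+ _]mulr_natl.
by have := lnn_fact_ge R x.+1; lra.
Qed.

End LSeries.

(** * Real characters *)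

Section RealCharacter.

Local Open Scope ring_scope.
Variable R : realType.
Implicit Types (n m x y p k d : nat).

(* With the sharp cutoff [x %/ d] in place of this weight, the error against the
   smooth term would be O(1) for each [d], too much to beat the contribution of
   the squares; here it is O(d/x). *)
Definition tent x d : R := \sum_(1 <= m < (x %/ d).+1) (1 - (d * m)%:R / x%:R).

Lemma sum_nat_id k : 2 * \sum_(1 <= m < k.+1) m%:R = k%:R * (k%:R + 1) :> R.
Proof.
elim: k => [|k IHk]; first by rewrite big_geq // mulr0 mul0r.
by rewrite big_nat_recr //= mulrDr IHk -natr1; ring.
Qed.

Lemma tentE x d : (0 < d)%N -> (0 < x)%N ->
  tent x d = x%:R / (2 * d%:R) - 2^-1 +
    (x %% d)%:R * (d%:R - (x %% d)%:R) / (2 * x%:R * d%:R).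
Proof.
move=> d0 x0; have dR : d%:R != 0 :> R by rewrite pnatr_eq0 -lt0n.
have xR : x%:R != 0 :> R by rewrite pnatr_eq0 -lt0n.
rewrite /tent sumrB sumr_const_nat subn1 /=.
under eq_bigr do rewrite natrM mulrAC.
rewrite -mulr_sumr; have := sum_nat_id (x %/ d); move: (\sum_(_ <= _ < _) _) => s sE.
have xE : x%:R = (x %/ d)%:R * d%:R + (x %% d)%:R :> R.
  by rewrite -natrM -natrD -divn_eq.
move: (x %/ d)%:R (x %% d)%:R sE xE => q r sE xE.
have -> : r = x%:R - q * d%:R by rewrite xE; ring.
have -> : s = q * (q + 1) / 2 by rewrite -sE; field.
by field; rewrite ?xR ?dR.
Qed.

(** The error is [r (d - r) / (2 x d)] with [r = x %% d], and [0 <= r <= d]. *)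
Lemma tent_error x d : (0 < d)%N -> (0 < x)%N ->
  0 <= tent x d - (x%:R / (2 * d%:R) - 2^-1) <= d%:R / (2 * x%:R).
Proof.
move=> d0 x0; rewrite tentE // addrAC subrr add0r.
have dR : 0 < d%:R :> R by rewrite ltr0n.
have xR : 0 < x%:R :> R by rewrite ltr0n.
have rd : (x %% d)%:R <= d%:R :> R by rewrite ler_nat ltnW // ltn_pmod.
have r0 : 0 <= (x %% d)%:R :> R by [].
apply/andP; split.
  by rewrite divr_ge0 ?mulr_ge0 ?subr_ge0 // ltW.
rewrite ler_pdivrMr ?mulr_gt0 // [leRHS](_ : _ = d%:R * d%:R); last by field; rewrite gt_eqF.
by rewrite ler_pM ?subr_ge0 // gerBl.
Qed.

Lemma tent_le x d : (0 < d <= x)%N -> tent x d <= x%:R / (2 * d%:R).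
Proof.
move=> /andP[d0 dx]; have x0 := leq_trans d0 dx; have /andP[_] := tent_error d0 x0.
have : d%:R / (2 * x%:R) <= 2^-1 :> R.
  rewrite invfM mulrCA -[leRHS]mulr1 ler_wpM2l ?invr_ge0 //.
  by rewrite ler_pdivrMr ?ltr0n // mul1r ler_nat.
by move: (_ / (_ * x%:R)) (_ / (_ * d%:R)) => u v; lra.
Qed.

Lemma tent_term_ge0 x d m : (m < (x %/ d).+1)%N -> 0 <= 1 - (d * m)%:R / x%:R :> R.
Proof.
case: x => [|x] mx; first by rewrite invr0 mulr0 subr0.
rewrite subr_ge0 ler_pdivrMr ?ltr0n // mul1r ler_nat mulnC.
by apply: leq_trans (leq_trunc_div x.+1 d); rewrite leq_mul2r -ltnS mx orbT.
Qed.

Lemma tent_ge0 x d : 0 <= tent x d.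
Proof.
by rewrite /tent big_nat sumr_ge0 // => m /andP[_ mx]; apply: tent_term_ge0.
Qed.

Lemma tent_dec x d : (0 < d)%N -> tent x d.+1 <= tent x d.
Proof.
move=> d0; rewrite /tent [leRHS](big_cat_nat (n := (x %/ d.+1).+1)) //=; last first.
  by rewrite ltnS leq_div2l.
rewrite -[leLHS]addr0 lerD //.
  apply: ler_sum_nat => m _; rewrite lerD2l lerN2 ler_wpM2r ?invr_ge0 // ler_nat.
  by rewrite leq_mul2r leqnSn orbT.
by rewrite big_nat sumr_ge0 // => m /andP[_ mx]; apply: tent_term_ge0.
Qed.

Variable X : nat -> R.
Hypothesis X1 : X 1%N = 1.
Hypothesis XM : forall m n, X (m * n)%N = X m * X n.
Hypothesis X_real : forall n, [\/ X n = 0, X n = 1 | X n = -1].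

Definition conv1 n := \sum_(d <- divisors n) X d.

(** For [X p] equal to 0, 1, -1 the sum is 1, [k + 1], or alternately 1 and 0. The parity form
    serves both the nonnegativity of [1 * X] and its bound on squares. *)
Lemma geom_ge p k : (~~ odd k)%:R <= \sum_(i < k.+1) X p ^+ i.
Proof.
case: (X_real p) => ->.
- by rewrite big_ord_recl big1 ?addr0 => [|i _]; [case: odd | rewrite expr0n].
- under eq_bigr do rewrite expr1n.
  by rewrite sumr_const card_ord; case: odd; rewrite ?ler0n // ler1n.
elim: k => [|k IHk]; first by rewrite big_ord1 expr0.
rewrite big_ord_recr /=; apply: le_trans (lerD IHk (lexx _)).
by rewrite -signr_odd /=; case: odd; rewrite /= ?expr1 ?expr0; lra.
Qed.

Lemma XX p k : X (p ^ k)%N = X p ^+ k.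
Proof. by elim: k => [|k IHk]; rewrite ?expn0 // expnS XM IHk exprS. Qed.

Lemma conv1_pfactor p k m : prime p -> ~~ (p %| m)%N -> (0 < m)%N ->
  conv1 (p ^ k * m)%N = (\sum_(i < k.+1) X p ^+ i) * conv1 m.
Proof.
move=> p_pr pm m0; rewrite /conv1 sum_divisors_pfactor // mulr_suml.
apply: eq_bigr => i _; rewrite mulr_sumr; apply: eq_bigr => d _.
by rewrite XM XX.
Qed.

Lemma conv1_ge0 n : (0 < n)%N -> 0 <= conv1 n.
Proof.
elim/pfactor_ind: n / => [|p k m p_pr k0 pm m0 IHm].
  by rewrite /conv1 big_seq1 X1.
by rewrite conv1_pfactor // mulr_ge0 //; apply: le_trans (geom_ge _ _).
Qed.

Lemma conv1_sqr_ge1 n : (0 < n)%N -> 1 <= conv1 (n * n)%N.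
Proof.
elim/pfactor_ind: n / => [|p k m p_pr k0 pm m0 IHm].
  by rewrite /conv1 big_seq1 X1.
rewrite mulnACA -expnD conv1_pfactor ?muln_gt0 ?m0 //; last by rewrite Euclid_dvdM // negb_or pm.
rewrite -[leLHS]mulr1 ler_pM //; apply: le_trans (geom_ge _ _).
by rewrite addnn odd_double.
Qed.

Lemma conv1_tent x :
  \sum_(1 <= n < x.+1) conv1 n * (1 - n%:R / x%:R) =
  \sum_(1 <= d < x.+1) X d * tent x d.
Proof.
under [RHS]eq_bigr do rewrite mulr_sumr.
rewrite -(sum_divisors_swap x (fun d m => X d * (1 - (d * m)%:R / x%:R))).
apply: eq_big_nat => n /andP[n0 _]; rewrite mulr_suml.
by apply: eq_big_seq => d; rewrite -dvdn_divisors // => dn; rewrite mulnC divnK.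
Qed.

(** Keep only the squares [m ^ 2] with [m <= y]: they are at most a quarter of the cutoff, so their
    weight is at least [3 / 4]. *)
Lemma conv1_tent_ge y : (0 < y)%N ->
  y%:R * (3 / 4) <= \sum_(1 <= n < (4 * y ^ 2).+1) conv1 n * (1 - n%:R / (4 * y ^ 2)%:R).
Proof.
move=> y0; set x := (4 * y ^ 2)%N; have xR : 0 < x%:R :> R by rewrite ltr0n muln_gt0 expn_gt0 y0.
have w0 n : (n < x.+1)%N -> 0 <= 1 - n%:R / x%:R :> R.
  by move=> nx; rewrite subr_ge0 ler_pdivrMr // mul1r ler_nat.
apply: le_trans (_ : \sum_(1 <= n < x.+1)
   (\sum_(1 <= m < y.+1) (m * m == n)%:R) * (1 - n%:R / x%:R) <= _); last first.
  apply: ler_sum_nat => n /andP[n0 nx]; rewrite ler_wpM2r ?w0 //.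
  have [/hasP/=[m m_y /eqP mn]|/hasPn nm] := boolP (has (fun m => m * m == n)%N (index_iota 1 y.+1)).
    subst n; rewrite (bigD1_seq m) ?iota_uniq //= eqxx big1 ?addr0.
      by rewrite conv1_sqr_ge1 //; rewrite mem_index_iota in m_y; case/andP: m_y.
    by move=> k km; rewrite !mulnn eqn_sqr (negPf km).
  by rewrite big_seq big1 ?conv1_ge0 // => m /nm /negPf ->.
under eq_bigr do rewrite mulr_suml.
rewrite exchange_big_nat /=.
apply: le_trans (_ : \sum_(1 <= m < y.+1) (3 / 4) <= _).
  by rewrite sumr_const_nat subn1 mulr_natl.
apply: ler_sum_nat => m /andP[m0 my].
have mx : (m * m * 4 <= x)%N by rewrite /x mulnC leq_mul2l /= -mulnn leq_mul.
rewrite (bigD1_seq (m * m)%N) ?iota_uniq //=; last first.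
  by rewrite mem_index_iota muln_gt0 m0 /=; lia.
rewrite eqxx mul1r big1 ?addr0 => [|n nm]; last by rewrite eq_sym (negPf nm) mul0r.
have : (m * m)%:R / x%:R <= 1 / 4 :> R.
  by rewrite ler_pdivrMr // mulrAC ler_pdivlMr // mul1r -natrM ler_nat.
by move: (_ / x%:R) => u; lra.
Qed.

Variables B C : R.
Hypothesis X_partial : forall n, `|\sum_(1 <= k < n.+1) X k| <= B.
Hypothesis X_L0 : forall x, `|\sum_(1 <= n < x.+1) X n / n%:R| <= C / x.+1%:R.

Lemma X_le1 n : `|X n| <= 1.
Proof. by case: (X_real n) => ->; rewrite ?normr0 ?normrN ?normr1. Qed.

(** For [d > D], sum by parts against the decreasing weight [tent x]. For [d <= D], replace the
    weight by [x / (2 d) - 1 / 2]: the first part is controlled by the vanishing L-value, the second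
    by the partial sums, and the [D] errors are at most [D / x] each. *)
Lemma conv1_tent_le x D : (0 < D < x)%N ->
  \sum_(1 <= d < x.+1) X d * tent x d <=
  (B + C) * (x%:R / D.+1%:R) + B + D%:R ^+ 2 / x%:R.
Proof.
move=> /andP[D0 Dx]; have x0 : (0 < x)%N by apply: leq_trans Dx.
have xR : 0 < x%:R :> R by rewrite ltr0n.
have DR : 0 < D.+1%:R :> R by rewrite ltr0n.
have B0 : 0 <= B by apply: le_trans (X_partial 0%N).
rewrite (big_cat_nat (n := D.+1)) //=; last by rewrite ltnW.
set S1 := \sum_(_ <= _ < _) _; set S2 := \sum_(_ <= _ < _) _.
have hi : S2 <= B * (x%:R / D.+1%:R).
  apply: le_trans (ler_norm _) _.
  apply: le_trans (abel_bound (B := B) (ltnW Dx) X_partial _ _) _.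
  - by move=> n Dn _; rewrite tent_dec // (leq_ltn_trans _ Dn).
  - by move=> n _ _; rewrite tent_ge0.
  rewrite Dx -mulrA mulrCA ler_wpM2l //.
  have := @tent_le x D.+1 Dx; rewrite invfM mulrCA.
  by move: (_ / D.+1%:R) => u; lra.
have lo : S1 <= C * (x%:R / D.+1%:R) + B + D%:R ^+ 2 / x%:R.
  have -> : S1 = x%:R / 2 * (\sum_(1 <= d < D.+1) X d / d%:R)
      - 2^-1 * (\sum_(1 <= d < D.+1) X d)
      + \sum_(1 <= d < D.+1) X d * (tent x d - (x%:R / (2 * d%:R) - 2^-1)).
    rewrite !mulr_sumr -sumrB -big_split /=; apply: eq_bigr => d _.
    by rewrite invfM; ring.
  have C0 : 0 <= C.
    by have := X_L0 0%N; rewrite invr1 mulr1; apply: le_trans.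
  have h1 : x%:R / 2 * (\sum_(1 <= d < D.+1) X d / d%:R) <= C * (x%:R / D.+1%:R).
    apply: le_trans (_ : x%:R / 2 * (C / D.+1%:R) <= _).
      by rewrite ler_wpM2l ?divr_ge0 //; apply: le_trans (ler_norm _) (X_L0 D).
    have : 0 <= C * (x%:R / D.+1%:R) by rewrite mulr_ge0 // divr_ge0.
    have -> : x%:R / 2 * (C / D.+1%:R) = C * (x%:R / D.+1%:R) / 2 by ring.
    by move: (C * _) => u; lra.
  have h2 : - (2^-1 * (\sum_(1 <= d < D.+1) X d)) <= B.
    by have := X_partial D; rewrite ler_norml => /andP[]; lra.
  apply: lerD; first exact: lerD.
  apply: le_trans (_ : \sum_(1 <= d < D.+1) D%:R / x%:R <= _); last first.
    by rewrite sumr_const_nat subn1 /= -[_ / _ *+ _]mulr_natl mulrA.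
  apply: ler_sum_nat => d /andP[d0 dD]; apply: le_trans (ler_norm _) _.
  have /andP[t0 t1] := tent_error d0 x0.
  rewrite normrM (ger0_norm t0) -[leRHS]mul1r ler_pM ?X_le1 //.
  apply: le_trans t1 _; rewrite invfM mulrA ler_wpM2r ?invr_ge0 //.
  rewrite ler_pdivrMr // -natrM ler_nat; lia.
apply: le_trans (lerD lo hi) _; rewrite mulrDl.
by move: (_ / D.+1%:R) (_ / x%:R) => u v; lra.
Qed.

(* For [x = 4 z^6] and [D = z^4], the squares contribute at least [3/4 z^3],
   while the upper bound is O(z^2). *)
Lemma real_character_L1_neq0 : False.
Proof.
have B0 : 0 <= B by apply: le_trans (X_partial 0%N).
have C0 : 0 <= C.
  by have := X_L0 0%N; rewrite invr1 mulr1; apply: le_trans.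
(* [E z^2] dominates the three terms of the upper bound, and [z > 2 E] puts it below [3/4 z^3]. *)
pose E := 4 * (B + C) + B + 1.
have E0 : 0 <= E by rewrite /E; lra.
pose z := (Num.Def.archi_bound (2 * E)).+1.
have zE : 2 * E < z%:R.
  by apply: lt_le_trans (_ : (Num.Def.archi_bound (2 * E))%:R <= _);
    [rewrite archi_boundP // mulr_ge0 | rewrite ler_nat].
have z0 : (0 < z)%N by [].
have zR : 0 < z%:R :> R by rewrite ltr0n.
have z1 : 1 <= z%:R :> R by rewrite ler1n.
have Dx : (0 < z ^ 4 < 4 * (z ^ 3) ^ 2)%N.
  rewrite expn_gt0 z0 /= -expnM; apply: leq_ltn_trans (leq_pexp2l z0 (isT : 4 <= 6)%N) _.
  by rewrite ltn_Pmull // expn_gt0 z0.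
have y0 : (0 < z ^ 3)%N by rewrite expn_gt0 z0.
have := conv1_tent_le Dx; rewrite -conv1_tent => /(le_trans (conv1_tent_ge y0)).
apply/negP; rewrite -ltNge.
have h1 : (4 * (z ^ 3) ^ 2)%:R / (z ^ 4).+1%:R <= 4 * z%:R ^+ 2 :> R.
  rewrite ler_pdivrMr ?ltr0n // -natrX -!natrM ler_nat.
  have -> : ((z ^ 3) ^ 2 = z ^ 2 * z ^ 4)%N by rewrite -expnM -expnD.
  by rewrite mulnA leq_mul2l leqnSn orbT.
have h2 : (z ^ 4)%:R ^+ 2 / (4 * (z ^ 3) ^ 2)%:R <= z%:R ^+ 2 :> R.
  rewrite ler_pdivrMr ?ltr0n ?muln_gt0 ?expn_gt0 ?z0 // -!natrX -natrM ler_nat.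
  have -> : ((z ^ 4) ^ 2 = z ^ 2 * (z ^ 3) ^ 2)%N by rewrite -!expnM -expnD.
  by rewrite mulnCA leq_pmull.
have h3 : B <= B * z%:R ^+ 2 by rewrite ler_peMr // expr_ge1.
apply: le_lt_trans (lerD (lerD (ler_wpM2l (addr_ge0 B0 C0) h1) h3) h2) _.
have -> : (B + C) * (4 * z%:R ^+ 2) + B * z%:R ^+ 2 + z%:R ^+ 2 = E * z%:R ^+ 2.
  by rewrite /E; ring.
rewrite natrX exprSr [ltRHS](_ : _ = (z%:R * (3 / 4)) * z%:R ^+ 2); last by ring.
by rewrite ltr_pM2r; [lra | rewrite expr1 mulr_gt0].
Qed.

End RealCharacter.

(** * Dirichlet's theorem *)

Section PrimeDistribution.

Local Open Scope ring_scope.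
Variable R : realType.
Variable N : nat.
Hypothesis N_gt0 : (0 < N)%N.
Implicit Types (n m x y p k d g h s : nat) (f ell F : nat -> R).

Notation mangoldt := (@mangoldt R).
Notation classfun := (@classfun R N).
Notation classfun0 := (@classfun0 R N).

Definition mangoldt_bdd F :=
  bdd (fun x => \sum_(1 <= n < x.+1) mangoldt n / n%:R * F n).

Definition inclass h n : R := (n == h %[mod N])%:R.

(** That all unit classes are rich is a quantitative form of Dirichlet's theorem; at this stage rich
    classes are only those on which bounded sums give information. *)
Definition rich h := coprime h N /\ ~ mangoldt_bdd (inclass h).

Lemma mangoldt_bddD F1 F2 : mangoldt_bdd F1 -> mangoldt_bdd F2 ->
  mangoldt_bdd (fun n => F1 n + F2 n).
Proof.
move=> h1 h2; apply: eq_bdd (bddD h1 h2) => x.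
by rewrite -big_split; apply: eq_bigr => n _; rewrite mulrDr.
Qed.

Lemma mangoldt_bddZ a F : mangoldt_bdd F -> mangoldt_bdd (fun n => a * F n).
Proof.
move=> h; apply: eq_bdd (bddZ a h) => x.
by rewrite mulr_sumr; apply: eq_bigr => n _; rewrite mulrCA.
Qed.

Lemma eq_mangoldt_bdd F1 F2 : F1 =1 F2 -> mangoldt_bdd F1 -> mangoldt_bdd F2.
Proof.
by move=> eqF; apply: eq_bdd => x; apply: eq_bigr => n _; rewrite eqF.
Qed.

(** [F] is a finite combination of indicators of unit classes that are not rich, each with a bounded
    sum. *)
Lemma mangoldt_bdd_vanish F : classfun F -> (forall h, rich h -> F h = 0) ->
  mangoldt_bdd F.
Proof.
move=> [FM F0] Fr; apply: (@eq_mangoldt_bdd (fun n => \sum_(0 <= h < N) F h * inclass h n)).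
  move=> n; rewrite big_mkord (bigD1 (Ordinal (ltn_pmod n N_gt0))) //= FM.
  rewrite big1 ?addr0 => [|i ni]; first by rewrite /inclass modn_mod eqxx mulr1.
  rewrite /inclass (modn_small (ltn_ord i)); case: eqP => [ni'|]; last by rewrite mulr0.
  by case/eqP: ni; apply: val_inj.
apply: eq_bdd (@bdd_sum _ _ (index_iota 0 N)
  (fun h x => \sum_(1 <= n < x.+1) mangoldt n / n%:R * (F h * inclass h n)) _) => [x|h].
  by rewrite exchange_big_nat; apply: eq_bigr => n _; rewrite mulr_sumr.
case: (boolP (coprime h N)) => hN; last first.
  by apply: eq_bdd (@bdd0 R) => x; rewrite big1 // => n _; rewrite F0 // mul0r mulr0.
have [hb|hr] := pselect (mangoldt_bdd (inclass h)); first exact: mangoldt_bddZ.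
by apply: eq_bdd (@bdd0 R) => x; rewrite big1 // => n _; rewrite Fr // mul0r mulr0.
Qed.

Lemma mangoldt_bdd_coprime c :
  mangoldt_bdd (fun n => (coprime n N)%:R * c) -> c = 0.
Proof.
move=> cb; apply: (@lnn_unbdd R).
apply: eq_bdd (bddB cb (bddZ c (mertens_coprime R N_gt0))) => x.
rewrite mulrBr mulr_sumr opprB addrCA -sumrB big1 ?addr0 // => n _; ring.
Qed.

Definition rich_invariant f := forall g s, rich s -> f (g * s)%N = f g.

(** For an invariant class function [F], the values [F (g n)] may be replaced by [F g] on units, up
    to [O(1)] in the [Lambda] sums. Since [ell] inherits the invariance, [mangoldt_Lval_bdd] becomes
    [ell g * ln x = O(1)], so [ell = 0]; then [mangoldt_Lval0_bdd] becomes [2 f g * ln x = O(1)]. *)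
Lemma rich_invariant_eq0 f : classfun0 f -> rich_invariant f -> forall g, f g = 0.
Proof.
move=> f0 fi; have fc := f0.1; have [C [ell fL]] := is_Lval_ex N_gt0 f0.
have ell0 := is_Lval_classfun N_gt0 f0 fL; have ellc := ell0.1.
have ell_inv : rich_invariant ell.
  move=> g s sr; apply: (cvg_rate_unique (fL _) (fL _)) => x; apply: eq_bigr => k _.
  by rewrite mulnAC fi.
have vanish F g : classfun F -> rich_invariant F ->
    mangoldt_bdd (fun n => (coprime n N)%:R * F g - F (g * n)%N).
  move=> Fc Fi; apply: mangoldt_bdd_vanish.
    have [FM FN] := classfun_shift g Fc; split=> n.
      by rewrite coprime_modl FM.
    by move=> nN; rewrite (negPf nN) mul0r FN // subr0.
  by move=> h hr; rewrite Fi // hr.1 mul1r subrr.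
have ell_eq0 : ell = fun=> 0.
  apply/funext => g; apply: mangoldt_bdd_coprime.
  apply: eq_mangoldt_bdd (mangoldt_bddD (vanish _ g ellc ell_inv)
    (mangoldt_Lval_bdd N_gt0 g f0 fL)) => n; exact: subrK.
move: fL; rewrite ell_eq0 => fL g.
have h1 := mangoldt_Lval0_bdd g f0 fL.
have h2 := bddZ (f g) (mertens_coprime R N_gt0).
suff /eqP : 2 * f g = 0 by rewrite mulf_eq0 pnatr_eq0 /= => /eqP.
apply: (@lnn_unbdd R); apply: eq_bdd (bddB (bddD h1 (vanish _ g fc fi)) h2) => x.
have -> : \sum_(1 <= n < x.+1) mangoldt n / n%:R * ((coprime n N)%:R * f g - f (g * n)%N) =
  f g * (\sum_(1 <= n < x.+1) mangoldt n / n%:R * (coprime n N)%:R) -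
  \sum_(1 <= n < x.+1) mangoldt n / n%:R * f (g * n)%N.
  by rewrite mulr_sumr -sumrB; apply: eq_bigr => n _; ring.
ring.
Qed.

Lemma classfun_coprime a : classfun (fun n => a * (coprime n N)%:R).
Proof. by split=> n; [rewrite coprime_modl | move/negPf->; rewrite mulr0]. Qed.

Lemma sum_coprime_neq0 : \sum_(0 <= i < N) (coprime i N)%:R != 0 :> R.
Proof.
rewrite big_mkord (bigD1 (Ordinal (ltn_pmod 1 N_gt0))) //= coprime_modl coprime1n.
by rewrite gt_eqF // ltr_pwDl // sumr_ge0.
Qed.

(** The projection onto mean-zero class functions along the principal character. *)
Definition center f n : R := f n -
  (\sum_(0 <= i < N) f i) / (\sum_(0 <= i < N) (coprime i N)%:R) * (coprime n N)%:R.

Lemma classfun0_center f : classfun f -> classfun0 (center f).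
Proof.
move=> [fM fN]; have [cM cN] := classfun_coprime
  ((\sum_(0 <= i < N) f i) / (\sum_(0 <= i < N) (coprime i N)%:R)).
split; first split=> n; rewrite /center; first by rewrite fM cM.
  by move=> nN; rewrite fN // cN // subr0.
by rewrite sumrB -mulr_sumr divfK ?sum_coprime_neq0 // subrr.
Qed.

Lemma rich_invariant_const f : classfun f -> rich_invariant f ->
  exists c, forall g, f g = c * (coprime g N)%:R.
Proof.
move=> fc fi; exists ((\sum_(0 <= i < N) f i) / (\sum_(0 <= i < N) (coprime i N)%:R)).
move=> g; apply/eqP; rewrite -subr_eq0; apply/eqP.
apply: (rich_invariant_eq0 (classfun0_center fc)) => {}g s sr.
by rewrite /center fi // coprimeMl sr.1 andbT.
Qed.

Lemma ex_max_norm f : classfun f -> exists g0, forall n, `|f n| <= `|f g0|.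
Proof.
move=> [fM _]; exists [arg max_(i > Ordinal N_gt0) `|f (val i)|]%O => n.
case: arg_maxP => //= i _ imax; rewrite -fM.
exact: (imax (Ordinal (ltn_pmod n N_gt0)) isT).
Qed.

Lemma exp_totient_mod s g : coprime s N -> (g * s ^ totient N = g %[mod N])%N.
Proof. by move=> sN; rewrite -modnMmr Euler_exp_totient // modnMmr muln1. Qed.

Lemma Lval_inj f C : classfun0 f -> is_Lval f C (fun=> 0) -> forall g, f g = 0.
Proof.
move=> f0 fL; have fc := f0.1; have [fM fN] := fc.
have [g0 g0max] := ex_max_norm fc.
have [fg0|fg0] := eqVneq (f g0) 0.
  by move=> g; apply/eqP; rewrite -normr_le0 (le_trans (g0max g)) // fg0 normr0.
exfalso.
have g0N : coprime g0 N by apply: contraR fg0 => /fN ->.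
have extremal g s : `|f g| = `|f g0| -> rich s -> f (g * s)%N = - f g.
  move=> gmax [sN sr]; have [//|gs] := eqVneq (f (g * s)%N) (- f g).
  have fg : f g != 0 by rewrite -normr_gt0 gmax normr_gt0.
  (* Nonnegative because [|f g|] is maximal, and with bounded [Lambda] sum because the two [ln x]
     terms cancel. If [F s > 0], the indicator of the class of [s] is at most [F / F s], so [s] is
     not rich. *)
  pose F n := f g * (f (g * n)%N + (coprime n N)%:R * f g).
  have F_ge0 n : 0 <= F n.
    rewrite /F; case: (boolP (coprime n N)) => nN; last first.
      have -> : f (g * n)%N = 0 by rewrite fN // coprimeMl (negPf nN) andbF.
      by rewrite mul0r addr0 mulr0.
    rewrite mul1r mulrDr -[f g * f g]expr2 -real_normK ?num_real // expr2.
    have := ler_norm (- (f g * f (g * n)%N)); rewrite normrN normrM.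
    have : `|f g| * `|f (g * n)%N| <= `|f g| * `|f g|.
      by rewrite ler_wpM2l // gmax g0max.
    by move: (`|_| * `|_|) (`|_| * `|_|) (f g * f _) => u v w; lra.
  have Fs : 0 < F s.
    by rewrite lt_neqAle F_ge0 andbT eq_sym mulf_neq0 // sN mul1r addr_eq0.
  case: sr; apply: (@bdd_le _ _ (fun x => (F s)^-1 * (\sum_(1 <= n < x.+1) mangoldt n / n%:R * F n))).
    have T0 n : 0 <= mangoldt n / n%:R by rewrite divr_ge0 ?mangoldt_ge0.
    move=> x; rewrite !ger0_norm; first last.
    - by apply: sumr_ge0 => n _; rewrite mulr_ge0.
    - by rewrite mulr_ge0 ?invr_ge0 ?sumr_ge0 // => n _; rewrite mulr_ge0.
    rewrite mulrC ler_pdivlMr // mulr_suml; apply: ler_sum => n _.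
    rewrite -[leLHS]mulrA ler_wpM2l // /inclass; case: eqP => [ns|_]; last by rewrite mul0r.
    rewrite mul1r /F (classfun_eq (classfun_shift g fc) ns).
    by rewrite -(coprime_modl s) -ns coprime_modl.
  apply: bddZ.
  apply: eq_bdd (bddZ (f g) (bddD (mangoldt_Lval0_bdd g f0 fL)
    (bddZ (f g) (mertens_coprime R N_gt0)))) => x.
  have -> : \sum_(1 <= n < x.+1) mangoldt n / n%:R * F n =
    f g * (\sum_(1 <= n < x.+1) mangoldt n / n%:R * f (g * n)%N +
    f g * \sum_(1 <= n < x.+1) mangoldt n / n%:R * (coprime n N)%:R).
    by rewrite !mulr_sumr -big_split mulr_sumr; apply: eq_bigr => n _; rewrite /F /=; ring.
  by ring.
(* The set of maximal points is invariant under rich classes, hence consists of all units. *)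
pose e n : R := (`|f n| == `|f g0|)%:R.
have ec : classfun e.
  split=> n; first by rewrite /e fM.
  by move=> nN; rewrite /e fN // normr0 eq_sym normr_eq0 (negPf fg0).
have e_step g s k : rich s -> `|f g| = `|f g0| -> `|f (g * s ^ k)%N| = `|f g0|.
  move=> sr gmax; elim: k => [|k IHk]; first by rewrite expn0 muln1.
  by rewrite expnSr mulnA extremal // normrN.
have e_inv : rich_invariant e.
  move=> g s sr; rewrite /e; congr (nat_of_bool _)%:R; apply/eqP/eqP => gmax; last first.
    by have := e_step g s 1 sr gmax; rewrite expn1.
  (* This power of [s] is its inverse modulo [N], which carries maximality from [g s] back to
     [g]. *)
  have := e_step _ s (totient N).-1 sr gmax.
  rewrite -mulnA -expnS prednK ?totient_gt0 //.
  by rewrite (classfun_eq fc (exp_totient_mod g sr.1)).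
have f_max g : coprime g N -> `|f g| = `|f g0|.
  have [c cE] := rich_invariant_const ec e_inv.
  move=> gN; have := cE g; rewrite gN -g0N -cE /e eqxx.
  by case: eqP => // _ /eqP; rewrite eq_sym oner_eq0.
have f_step g s : rich s -> f (g * s)%N = - f g.
  move=> sr; case: (boolP (coprime g N)) => gN; first by rewrite extremal // f_max.
  by rewrite !fN ?oppr0 // coprimeMl negb_and gN.
(* A rich factor flips both signs, so the product is invariant in [g], hence constant on units.
   Multiplicativity of [f / f 1] follows. *)
have fM1 g h : f (g * h)%N * f g = f h * f 1%N * (coprime g N)%:R.
  have hc : classfun (fun g => f (g * h)%N * f g).
    split=> n; first by rewrite fM mulnC (classfun_eq fc (modnMmr _ _ _)) mulnC.
    by move=> nN; rewrite (fN n) ?mulr0.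
  have hi : rich_invariant (fun g => f (g * h)%N * f g).
    by move=> k s sr; rewrite mulnAC !(f_step _ _ sr) mulrNN.
  have [c cE] := rich_invariant_const hc hi.
  by have := cE 1%N; rewrite coprime1n mulr1 mul1n => ->; rewrite cE.
have f1 : f 1%N != 0 by rewrite -normr_gt0 f_max ?coprime1n // normr_gt0.
pose X n := f n / f 1%N.
have f1_sqr g : coprime g N -> f g * f g = f 1%N * f 1%N.
  by move=> gN; have := fM1 g 1%N; rewrite muln1 gN mulr1.
have XM m n : X (m * n)%N = X m * X n.
  rewrite /X; case: (boolP (coprime m N)) => mN; last first.
    by rewrite (fN m) // (fN (m * n)%N) ?mul0r // coprimeMl negb_and mN.
  have fm : f m != 0 by rewrite -normr_gt0 f_max // normr_gt0.
  apply: (mulIf fm); rewrite mulrAC fM1 mN mulr1 mulfK //.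
  rewrite [RHS](_ : _ = f m * f m / (f 1%N * f 1%N) * f n); last by rewrite invfM; ring.
  by rewrite f1_sqr // divff ?mul1r // mulf_neq0.
have X_real n : [\/ X n = 0, X n = 1 | X n = -1].
  rewrite /X; case: (boolP (coprime n N)) => nN; last first.
    by apply: Or31; rewrite fN // mul0r.
  have /eqP := f1_sqr n nN; rewrite -!expr2 eqf_sqr => /orP[] /eqP ->.
    by apply: Or32; rewrite divff.
  by apply: Or33; rewrite mulNr divff.
apply: (@real_character_L1_neq0 R X _ XM X_real
  (N.+1%:R * mass N f * `|f 1%N|^-1) (C * `|f 1%N|^-1)).
- by rewrite /X divff.
- move=> n; rewrite -mulr_suml normrM normfV ler_wpM2r ?invr_ge0 //.
  have := partial_sum_le N_gt0 1 n f0.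
  by under eq_bigr do rewrite mul1n.
move=> x; rewrite mulrAC.
have -> : \sum_(1 <= n < x.+1) X n / n%:R = Lsum f x 1 / f 1%N.
  by rewrite /Lsum mulr_suml; apply: eq_bigr => n _; rewrite /X mul1n mulrAC.
rewrite normrM normfV ler_wpM2r ?invr_ge0 //.
by have := fL 1%N x; rewrite subr0.
Qed.

End PrimeDistribution.

(** * Surjectivity of [L] and primes in residue classes *)

Section PrimesInClasses.

Local Open Scope ring_scope.
Variable R : realType.
Variable N : nat.
Hypothesis N_gt0 : (0 < N)%N.
Implicit Types (n m x y p k d g h s : nat) (f ell F : nat -> R).

Notation mangoldt := (@mangoldt R).
Notation classfun := (@classfun R N).
Notation classfun0 := (@classfun0 R N).

(** An injective endomorphism of a finite-dimensional space is onto. In coordinates [v], the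
    function [w v] is the mean-zero projection and [lw v] its L-values. *)
Lemma Lval_surj F : classfun0 F -> exists f C, classfun0 f /\ is_Lval f C F.
Proof.
move=> F0.
pose b k n : R := (coprime k N)%:R * inclass R N k n.
have bc k : classfun (b k).
  split=> n; rewrite /b /inclass; first by rewrite modn_mod.
  case: eqP => [nk|_]; last by rewrite mulr0.
  by rewrite -coprime_modl nk coprime_modl => /negPf->; rewrite mul0r.
pose f k := center N (b k).
have f0 k : classfun0 (f k) := classfun0_center N_gt0 (bc k).
have /choice[L LP] (k : 'I_N) : exists u : R * (nat -> R), is_Lval (f k) u.1 u.2.
  by have [C [ell fL]] := is_Lval_ex N_gt0 (f0 k); exists (C, ell).
pose w (v : 'rV[R]_N) n := \sum_(k < N) v 0 k * f k n.
pose lw (v : 'rV[R]_N) n := \sum_(k < N) v 0 k * (L k).2 n.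
have w0 v : classfun0 (w v).
  split; first split=> n.
  - by apply: eq_bigr => k _; rewrite (f0 k).1.1.
  - by move=> nN; rewrite /w big1 // => k _; rewrite (f0 k).1.2 ?mulr0.
  by rewrite exchange_big big1 //= => k _; rewrite -mulr_sumr (f0 k).2 mulr0.
have lwP v : is_Lval (w v) (\sum_(k < N) `|v 0 k| * (L k).1) (lw v).
  move=> g x; have -> : Lsum (w v) x g = \sum_(k < N) v 0 k * Lsum (f k) x g.
    rewrite /Lsum; under eq_bigr do rewrite mulr_suml.
    rewrite exchange_big; apply: eq_bigr => k _; rewrite mulr_sumr.
    by apply: eq_bigr => n _; rewrite mulrA.
  rewrite -sumrB mulr_suml; apply: le_trans (ler_norm_sum _ _ _) _.
  apply: ler_sum => k _; rewrite -mulrBr normrM -mulrA ler_wpM2l //.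
  exact: LP.
have wE (v : 'rV[R]_N) G : classfun0 G -> (forall k : 'I_N, v 0 k = G k) -> w v = G.
  move=> [[GM GN] Gs] vG; apply/funext => n.
  have bE m : \sum_(k < N) v 0 k * b k m = G m.
    rewrite (bigD1 (Ordinal (ltn_pmod m N_gt0))) //= vG GM big1 ?addr0 => [|i mi].
      rewrite /b /inclass modn_mod eqxx mulr1 coprime_modl.
      by case: (boolP (coprime m N)) => [_|/GN ->]; rewrite ?mulr1 ?mul0r.
    rewrite /b /inclass (modn_small (ltn_ord i)); case: eqP => [mi'|_]; last by rewrite !mulr0.
    by case/eqP: mi; apply: val_inj.
  rewrite /w /f /center; under eq_bigr do rewrite mulrBr.
  rewrite sumrB bE; under eq_bigr do rewrite !mulrA.
  rewrite -!mulr_suml; under eq_bigr do rewrite mulr_sumr.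
  by rewrite exchange_big /=; under eq_bigr do rewrite bE; rewrite Gs !mul0r subr0.
(* [M] acts as [L] on mean-zero class functions and as the identity on a
   complement. *)
pose M : 'M[R]_N := \matrix_(k, g) ((L k).2 g + (k == g)%:R - f k g).
have vM (v : 'rV[R]_N) (g : 'I_N) : (v *m M) 0 g = lw v g + v 0 g - w v g.
  rewrite mxE /lw /w; under eq_bigr do rewrite mxE mulrBr mulrDr.
  rewrite sumrB big_split /=; congr (_ + _ - _).
  rewrite (bigD1 g) //= eqxx mulr1 big1 ?addr0 // => i /negPf->; exact: mulr0.
have lw0 v : classfun0 (lw v) := is_Lval_classfun N_gt0 (w0 v) (lwP v).
have class0B G H : classfun0 G -> classfun0 H -> classfun0 (fun n => G n - H n).
  move=> [[GM GN] Gs] [[HM HN] Hs]; split; first split=> n; rewrite ?GM ?HM //.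
    by move=> nN; rewrite GN // HN // subr0.
  by rewrite sumrB Gs Hs subr0.
have M_unit : M \in unitmx.
  rewrite -row_free_unit; apply: inj_row_free => v v0.
  (* So a kernel vector is itself a mean-zero class function, equal to [w v]; then [lw v = 0], and
     injectivity of [L] applies. *)
  have vE (k : 'I_N) : v 0 k = w v k - lw v k.
    by apply/eqP; rewrite -subr_eq0 opprB addrA addrAC addrC addrA -vM v0 mxE.
  have wv := wE _ _ (class0B _ _ (w0 v) (lw0 v)) vE.
  have lw_eq0 n : lw v n = 0.
    by have := congr1 (@^~ n) wv => /eqP; rewrite -subr_eq0 opprB addrCA subrr addr0 => /eqP.
  have wL : is_Lval (w v) (\sum_(k < N) `|v 0 k| * (L k).1) (fun=> 0).
    by move=> g x; have := lwP v g x; rewrite lw_eq0.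
  apply/rowP => k; rewrite vE lw_eq0 subr0 mxE.
  exact: (Lval_inj N_gt0 (w0 v) wL).
pose v := (\row_(g < N) F g) *m invmx M.
(* Again [v] represents a mean-zero class function and so agrees with [w v], which leaves
   [lw v = F]. *)
have vE (k : 'I_N) : v 0 k = F k - (lw v k - w v k).
  have := vM v k; rewrite mulmxKV // mxE => ->; ring.
exists (w v), (\sum_(k < N) `|v 0 k| * (L k).1); split=> // g x.
have wv := wE _ _ (class0B _ _ F0 (class0B _ _ (lw0 v) (w0 v))) vE.
have -> : F g = lw v g by have := congr1 (@^~ g) wv => /=; lra.
exact: lwP.
Qed.

(** Let [g] be inverse to [h], so that [g n = 1] picks out the class of [h]. As [L] is onto, the
    centered indicator of 1, shifted by [g], has bounded [Lambda] sum. Without primes in the class,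
    the uncentered part is bounded too, as only higher prime powers contribute. This forces the mean
    [c = 1 / totient N] to be 0. *)
Lemma dirichlet_realType h : coprime h N -> exists2 p, prime p & p = h %[mod N].
Proof.
move=> hN; have [//|no_prime] := pselect (exists2 p, prime p & p = h %[mod N]); exfalso.
pose g := (h ^ (totient N).-1)%N.
have gh : (h * g = 1 %[mod N])%N.
  by rewrite /g -expnS prednK ?totient_gt0 // Euler_exp_totient.
have gN : coprime g N by rewrite coprimeXl.
have ic : classfun (inclass R N 1).
  split=> n; rewrite /inclass; first by rewrite modn_mod.
  by case: eqP => // n1; rewrite -coprime_modl n1 coprime_modl coprime1n.
have [f [C [f0 fL]]] := Lval_surj (classfun0_center N_gt0 ic).
have := mangoldt_Lval_bdd N_gt0 g f0 fL.
have np : mangoldt_bdd (fun n => inclass R N 1 (g * n)).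
  exists 8 => x; rewrite ger0_norm; last first.
    by apply: sumr_ge0 => n _; rewrite mulr_ge0 // divr_ge0 ?mangoldt_ge0.
  apply: le_trans (sum_mangoldt_nonprime_le R x); apply: ler_sum => n _.
  have T0 : 0 <= mangoldt n / n%:R by rewrite divr_ge0 ?mangoldt_ge0.
  rewrite /inclass; case: eqP => [gn|_]; last by rewrite mulr0; case: ifP.
  rewrite mulr1; case: ifP => // n_pr; case: no_prime; exists n => //.
  by rewrite -[n in LHS]mul1n -modnMml -gh modnMml -mulnA -modnMmr gn modnMmr muln1.
move=> cb; set c := (\sum_(0 <= i < N) inclass R N 1 i) / (\sum_(0 <= i < N) (coprime i N)%:R).
have /eqP : c = 0.
  apply: (mangoldt_bdd_coprime N_gt0).
  apply: eq_mangoldt_bdd (mangoldt_bddD np (mangoldt_bddZ (-1) cb)) => n.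
  by rewrite /center -/c coprimeMl gN; ring.
rewrite mulf_eq0 invr_eq0 (negPf (sum_coprime_neq0 R N_gt0)) orbF.
rewrite big_mkord (bigD1 (Ordinal (ltn_pmod 1 N_gt0))) //= gt_eqF // ltr_pwDl //.
  by rewrite /inclass modn_mod eqxx.
by apply: sumr_ge0.
Qed.

End PrimesInClasses.

Theorem dirichlet N h : 0 < N -> coprime h N ->
  exists2 p, prime p & p = h %[mod N].
Proof. by move=> N0; apply: (dirichlet_realType (Rdefinitions.R : realType)). Qed.

(** * Walks of length six *)

Lemma dist_le x y n : walk x y n -> dist x y <= n.
Proof.
by move=> xy; rewrite /dist; case: ex_minnP => m _; apply; apply/asboolP.
Qed.

Lemma vertex_ex n : 0 < n -> exists v : vertex, val v = n.
Proof. by case: n => // n _; pose v : vertex := exist _ n.+1 isT; exists v. Qed.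

Lemma adj_mul (x y : vertex) p : prime p -> val y = val x * p -> adj x y.
Proof.
move=> p_pr yE; have x0 : 0 < val x := valP x.
have xy : val x <= val y by rewrite yE leq_pmulr // prime_gt0.
by apply/or3P/Or33; rewrite /= (minn_idPl xy) (maxn_idPr xy) yE dvdn_mulr ?mulKn.
Qed.

Lemma adj_succ (x y : vertex) : val y = (val x).+1 -> adj x y.
Proof. by move=> yE; apply/or3P/Or32; rewrite yE. Qed.

(** * The congruence for units modulo [M] *)

Lemma coprime_inverse M u : 0 < M -> coprime u M -> exists2 v, coprime v M & u * v = 1 %[mod M].
Proof.
move=> M0 uM; exists (u ^ (totient M).-1); first by rewrite coprimeXl.
by rewrite -expnS prednK ?totient_gt0 // Euler_exp_totient.
Qed.

(** Units stand in for the primes of the walk, so that the Chinese remainder theorem applies;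
    [dirichlet] turns them into primes at the end. *)
Definition reachable_mod a Y M := exists p q s,
  [/\ coprime p M, coprime q M, coprime s M & ((a * p + 1) * q + 1) * s = Y %[mod M]].

Lemma eqmodD M m m' n n' : m = m' %[mod M] -> n = n' %[mod M] -> m + n = m' + n' %[mod M].
Proof. by move=> mm' nn'; rewrite -modnDm mm' nn' modnDm. Qed.

Lemma eqmodM M m m' n n' : m = m' %[mod M] -> n = n' %[mod M] -> m * n = m' * n' %[mod M].
Proof. by move=> mm' nn'; rewrite -modnMm mm' nn' modnMm. Qed.

Lemma eqmod_target a M p q s p' q' s' :
  p = p' %[mod M] -> q = q' %[mod M] -> s = s' %[mod M] ->
  ((a * p + 1) * q + 1) * s = ((a * p' + 1) * q' + 1) * s' %[mod M].
Proof.
by move=> *; do !(apply: eqmodM || apply: eqmodD).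
Qed.

Lemma coprime_eqmod M m n : m = n %[mod M] -> coprime m M = coprime n M.
Proof. by move=> mn; rewrite -coprime_modl mn coprime_modl. Qed.

Lemma reachable_mod_crt a Y M1 M2 : coprime M1 M2 ->
  reachable_mod a Y M1 -> reachable_mod a Y M2 -> reachable_mod a Y (M1 * M2).
Proof.
move=> cM [p1 [q1 [s1 [cp1 cq1 cs1 E1]]]] [p2 [q2 [s2 [cp2 cq2 cs2 E2]]]].
pose c u1 u2 := chinese M1 M2 u1 u2.
have cl u1 u2 : c u1 u2 = u1 %[mod M1] := chinese_modl cM u1 u2.
have cr u1 u2 : c u1 u2 = u2 %[mod M2] := chinese_modr cM u1 u2.
have cc u1 u2 : coprime u1 M1 -> coprime u2 M2 -> coprime (c u1 u2) (M1 * M2).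
  by move=> c1 c2; rewrite coprimeMr (coprime_eqmod (cl _ _)) (coprime_eqmod (cr _ _)) c1.
exists (c p1 p2), (c q1 q2), (c s1 s2); split; try exact: cc.
apply/eqP; rewrite chinese_remainder //; apply/andP; split; apply/eqP.
  by rewrite -E1; apply: eqmod_target.
by rewrite -E2; apply: eqmod_target.
Qed.

(** Solve for [q = (Y - s) / ((a p + 1) s)]; the natural number [s * M.-1] represents [- s]. *)
Lemma reachable_mod_solve a Y M p s : 0 < M -> coprime p M -> coprime s M ->
  coprime (a * p + 1) M -> coprime (Y + s * M.-1) M -> reachable_mod a Y M.
Proof.
move=> M0 pM sM AM YM.
have [v vM Av] : exists2 v, coprime v M & (a * p + 1) * s * v = 1 %[mod M].
  by apply: coprime_inverse; rewrite // coprimeMl AM.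
exists p, ((Y + s * M.-1) * v), s; split=> //; first by rewrite coprimeMl YM.
have -> : ((a * p + 1) * ((Y + s * M.-1) * v) + 1) * s =
  (Y + s * M.-1) * ((a * p + 1) * s * v) + s by ring.
rewrite -modnDml -modnMmr Av modnMmr modnDml muln1 -addnA -mulnSr prednK //.
by rewrite addnC modnMDl.
Qed.

Lemma reachable_mod_pfactor a Y l k : prime l -> odd a = odd Y ->
  reachable_mod a Y (l ^ k).
Proof.
move=> l_pr aY; have l1 := prime_gt1 l_pr.
case: k => [|k]; first by exists 1, 1, 1; rewrite !modn1.
have M0 : 0 < l ^ k.+1 by rewrite expn_gt0 prime_gt0.
have lM n : coprime n (l ^ k.+1) = ~~ (l %| n).
  by rewrite coprime_pexpr // coprime_sym prime_coprime.
have Yl s : coprime (Y + s * (l ^ k.+1).-1) (l ^ k.+1) = (Y != s %[mod l]).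
  rewrite lM; congr (~~ _).
  rewrite -(eqn_modDr (s * (l ^ k.+1).-1)) (addnC s) -mulnSr prednK //.
  by rewrite expnS mulnCA modnMr.
have [l2|l2] := eqVneq l 2.
  (* For [a] odd, [a p + 1] is even for every unit [p]; instead [p = q = 1] makes the last factor
     the unit [a + 2], and [s] is solved for, [Y] being odd. For [a] even, [a + 1] and [Y - 1] are
     odd. *)
  subst l; case: (boolP (odd a)) => a_odd.
    have [v vM av] : exists2 v, coprime v (2 ^ k.+1) & (a + 2) * v = 1 %[mod 2 ^ k.+1].
      by apply: coprime_inverse; rewrite // lM dvdn2 oddD a_odd.
    exists 1, 1, (Y * v); split; rewrite ?coprime1n //.
      by rewrite coprimeMl vM lM dvdn2 -aY a_odd.
    have -> : ((a * 1 + 1) * 1 + 1) * (Y * v) = Y * ((a + 2) * v) by ring.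
    by rewrite -modnMmr av modnMmr muln1.
  apply: (@reachable_mod_solve _ _ _ 1 1) => //; rewrite ?coprime1n //.
    by rewrite lM dvdn2 muln1 addn1 /= negbK.
  by rewrite Yl !modn2 -aY (negPf a_odd).
(* For odd [l], 1 and 2 are distinct nonzero residues, and one of them always works: [l] cannot
   divide both [a + 1] and [2 a + 1], nor can [Y] be congruent to both. *)
have [p pl pA] : exists2 p, ~~ (l %| p) & ~~ (l %| a * p + 1).
  have [la|la] := boolP (l %| a + 1); last by exists 1; rewrite ?muln1 // dvdn1; lia.
  exists 2; first by rewrite dvdn_prime2.
  have -> : a * 2 + 1 = a + (a + 1) by ring.
  by rewrite dvdn_addl //; apply: contraL la => la; rewrite dvdn_addr // dvdn1; lia.
have [s sl sY] : exists2 s, ~~ (l %| s) & Y != s %[mod l].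
  have [Y1|Y1] := eqVneq (Y %% l) (1 %% l); last by exists 1; rewrite // dvdn1; lia.
  exists 2; first by rewrite dvdn_prime2.
  rewrite Y1 !modn_small //; lia.
by apply: (@reachable_mod_solve _ _ _ p s); rewrite ?Yl ?lM.
Qed.

Lemma reachable_modT a Y M : 0 < M -> odd a = odd Y -> reachable_mod a Y M.
Proof.
move=> M0 aY; elim/pfactor_ind: M / M0 => [|l k m l_pr k0 lm m0 IHm].
  exact: (@reachable_mod_pfactor a Y 2 0).
apply: reachable_mod_crt => //; last exact: reachable_mod_pfactor.
by rewrite coprimeXl // prime_coprime.
Qed.

Lemma prime_path a Y M : 0 < M -> odd a = odd Y -> exists p q s,
  [/\ prime p, prime q, prime s & ((a * p + 1) * q + 1) * s = Y %[mod M]].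
Proof.
move=> M0 aY; have [p [q [s [pM qM sM <-]]]] := reachable_modT M0 aY.
have [p' p'_pr pp] := dirichlet M0 pM.
have [q' q'_pr qq] := dirichlet M0 qM.
have [s' s'_pr ss] := dirichlet M0 sM.
by exists p', q', s'; split=> //; apply: eqmod_target.
Qed.

Theorem corollary6p2 (a : vertex) (S : congr_system) :
  (exists z : int, satisfies S z) ->
  exists b : vertex, satisfies S (Posz (val b)) /\ dist a b <= 6.
Proof.
case=> z [r rS _]; set M := modulus S in r rS.
have M0 : 0 < M := modulus_gt0 S; have a0 : 0 < val a := valP a.
have goal_of (b : vertex) n : val b = r %[mod M] -> walk a b n -> n <= 6 ->
    satisfies S (Posz (val b)) /\ dist a b <= 6.
  move=> br ab n6; split; last exact: leq_trans (dist_le ab) n6.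
  by exists r => //; rewrite !modz_nat br.
(* [r + 2M - 1] stands for the class of [r - 1], reached before a last step [+1]. *)
pose Y := if odd (val a) == odd r then nat_of_ord r else r + M.*2.-1.
have aY : odd (val a) = odd Y.
  rewrite /Y; case: eqP => // ar; rewrite oddD -subn1 oddB ?double_gt0 // odd_double.
  by case: odd ar; case: odd.
have [p [q [s [p_pr q_pr s_pr E]]]] := prime_path M0 aY.
have p0 := prime_gt0 p_pr; have q0 := prime_gt0 q_pr; have s0 := prime_gt0 s_pr.
have [v1 E1] : exists v : vertex, val v = val a * p.
  by apply: vertex_ex; rewrite muln_gt0 ?a0.
pose v2 : vertex := exist _ (val v1).+1 isT.
have [v3 E3] : exists v : vertex, val v = val v2 * q.
  by apply: vertex_ex; rewrite muln_gt0 ?a0.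
pose v4 : vertex := exist _ (val v3).+1 isT.
have [v5 E5] : exists v : vertex, val v = val v4 * s.
  by apply: vertex_ex; rewrite muln_gt0 ?a0.
pose v6 : vertex := exist _ (val v5).+1 isT.
have w5 v n : walk v5 v n -> walk a v (5 + n).
  move=> w; apply: walk_step (adj_mul p_pr E1) _.
  apply: walk_step (adj_succ (erefl (val v2))) _.
  apply: walk_step (adj_mul q_pr E3) _.
  apply: walk_step (adj_succ (erefl (val v4))) _.
  exact: walk_step (adj_mul s_pr E5) w.
have {}E : val v5 = Y %[mod M] by rewrite E5 /= E3 /= E1 -!addn1.
move: E; rewrite /Y; case: eqP => _ E.
  by exists v5; apply: goal_of E (w5 _ 0 _) _; rewrite //; exists [::].
exists v6; apply: goal_of (w5 _ 1 _) _ => //; last first.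
  by apply: walk_step (adj_succ (erefl (val v6))) _; exists [::].
rewrite /= -addn1 -modnDml E modnDml -addnA addn1 prednK ?double_gt0 //.
by rewrite -muln2 addnC mulnC modnMDl.
Qed.
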